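(* Let $\mathcal{X}$, $\mathcal{Y}$ and $\mathcal{Z}$ be locally Noetherian formal schemes and let $\alpha:\mathcal{Z}\to\mathcal{X}$ and $\beta:\mathcal{Z}\to\mathcal{Y}$ be closed immersions of formal schemes. Assume that for all $z\in\mathcal{Z}$ the ring $\mathcal{O}_{\mathcal{X},\alpha(z)}$ is not isomorphic to $\mathcal{O}_{\mathcal{Z},z}$ and the ring $\mathcal{O}_{\mathcal{Y},\beta(z)}$ is not isomorphic to $\mathcal{O}_{\mathcal{Z},z}$. Then there exists a singular point $w\in\mathcal{X}\sqcup_{\mathcal{Z}}\mathcal{Y}$.
   Context: Admissible rings: a topological commutative ring $R$ is linearly topologized if $0$ has a fundamental system of neighbourhoods consisting of ideals; an ideal $\mathfrak{a}$ is an ideal of definition if it is open and topologically nilpotent (every open ideal contains some power $\mathfrak{a}^n$); $R$ is complete if $R\to\varprojlim R/\mathfrak{a}_\lambda$ is an isomorphism for a fundamental system of open ideals $\{\mathfrak{a}_\lambda\}$; $R$ is admissible if it is linearly topologized, complete and has an ideal of definition; $R$ is adic if it is complete and has an ideal of definition $\mathfrak{a}$ such that $\{\mathfrak{a}^n\}_{n\ge0}$ is a fundamental system of neighbourhoods of $0$. Formal schemes: for $R$ admissible, with $\{\mathfrak{a}_\lambda\}$ the system of all its ideals of definition, $\mathrm{Spf}(R)$ is the closed subspace of $\mathrm{Spec}(R)$ consisting of the open prime ideals, equipped with the sheaf of topological rings $\varprojlim_\lambda\mathcal{O}_\lambda$, where $\mathcal{O}_\lambda$ is the structure sheaf of $\mathrm{Spec}(R/\mathfrak{a}_\lambda)$.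 A formal scheme is a topologically ringed space locally isomorphic to such $\mathrm{Spf}(R)$; morphisms are morphisms of topologically ringed spaces inducing local homomorphisms on stalks. A formal scheme is locally Noetherian if it has a cover by affine open formal subschemes $\mathrm{Spf}(R_i)$ with each $R_i$ Noetherian and adic. Gluing: for morphisms $\alpha:\mathcal{Z}\to\mathcal{X}$, $\beta:\mathcal{Z}\to\mathcal{Y}$, the space $\mathcal{X}\sqcup_{\mathcal{Z}}\mathcal{Y}$ is the quotient of the disjoint union $\mathcal{X}\coprod\mathcal{Y}$ (quotient topology) by the equivalence relation generated by $\alpha(z)\sim\beta(z)$, $z\in\mathcal{Z}$. With $f:\mathcal{X}\to\mathcal{X}\sqcup_{\mathcal{Z}}\mathcal{Y}$ and $g:\mathcal{Y}\to\mathcal{X}\sqcup_{\mathcal{Z}}\mathcal{Y}$ the natural maps, it carries the structure sheaf making it the pushout of $\alpha,\beta$ in ringed spaces: $U\mapsto \mathcal{O}_{\mathcal{X}}(f^{-1}U)\times_{\mathcal{O}_{\mathcal{Z}}((f\alpha)^{-1}U)}\mathcal{O}_{\mathcal{Y}}(g^{-1}U)$, with sections topologized as a subspace of the product. Singular points: a locally Noetherian formal scheme $\mathcal{W}$ is regular (nonsingular) at $w$ if $\mathcal{O}_{\mathcal{W},w}$ is a regular local ring (its embedding dimension equals its Krull dimension), and singular at $w$ otherwise.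
   Formalization: The formal theorem additionally assumes that Z is nonempty; for empty Z the conditions on stalks are vacuous and the claim fails, for example when X = Y = Spec k, whose disjoint union is regular. *)

(* Defs.v *)
From HB Require Import structures.
From Stdlib Require Import Relation_Operators.
From mathcomp Require Import all_boot all_algebra ring.
From mathcomp Require Import all_classical.
From mathcomp Require Import topology tvs.

Set Implicit Arguments.
Unset Strict Implicit.
Unset Printing Implicit Defensive.

Import GRing.Theory.
Local Open Scope classical_set_scope.
Local Open Scope ring_scope.

(* Rings are [comPzRingType]s, not [comNzRingType]s: sections over the empty
   set form the zero ring. *)
HB.mixin Record TopologicalZmodule_isTopologicalRing R
    & TopologicalZmodule R & GRing.ComPzRing R := {
  mulr_continuous : continuous (fun x : R * R => x.1 * x.2) }.

#[short(type="topComPzRingType")]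
HB.structure Definition TopComPzRing :=
  {R of TopologicalZmodule R & GRing.ComPzRing R &
        TopologicalZmodule_isTopologicalRing R}.

(** * Commutative algebra *)

Section Ideals.
Variable R : comPzRingType.
Implicit Types a b p m : set R.

Definition is_ideal a :=
  [/\ a 0, forall x y, a x -> a y -> a (x + y) & forall r x, a x -> a (r * x)].

Definition is_prime p :=
  [/\ is_ideal p, ~ p 1 & forall x y, p (x * y) -> p x \/ p y].

Definition is_maximal m :=
  [/\ is_ideal m, ~ m 1 &
      forall a, is_ideal a -> ~ a 1 -> m `<=` a -> a = m].

Definition idealM a b : set R :=
  [set x | exists n (u v : 'I_n -> R),
    [/\ forall i, a (u i), forall i, b (v i) & x = \sum_i u i * v i]].

Fixpoint idealX a n : set R :=
  if n is n'.+1 then idealM a (idealX a n') else setT.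

Definition noetherian :=
  forall a, is_ideal a -> exists n (g : 'I_n -> R),
    a = [set x | exists c : 'I_n -> R, x = \sum_i c i * g i].

Definition is_unit (x : R) := exists y, x * y = 1.

Definition local_ring_at m :=
  is_maximal m /\ forall m', is_maximal m' -> m' = m.

Definition prime_chain n :=
  exists p : nat -> set R,
    (forall i, (i <= n)%N -> is_prime (p i)) /\
    (forall i, (i < n)%N -> p i `<` p i.+1).

Definition krull_dim d := prime_chain d /\ forall n, prime_chain n -> (n <= d)%N.

(* The classes of [x] form a basis of m/m^2 over R/m. *)
Definition cotangent_basis m d (x : 'I_d -> R) :=
  [/\ forall i, m (x i),
      forall y, m y ->
        exists c : 'I_d -> R, idealX m 2 (y - \sum_i c i * x i) &
      forall c : 'I_d -> R, idealX m 2 (\sum_i c i * x i) -> forall i, m (c i)].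

Definition embedding_dim m d := exists x : 'I_d -> R, cotangent_basis m x.

Definition regular_local_ring :=
  noetherian /\
  exists m d, [/\ local_ring_at m, embedding_dim m d & krull_dim d].

End Ideals.

Definition ring_isomorphic (A B : comPzRingType) :=
  exists f : {rmorphism A -> B}, bijective f.

(** * Rings as quotients of setoids

   Stalks and local rings are sets of representatives (germs, fractions) modulo
   an equivalence relation, the ring axioms holding up to that relation. *)

Record ring_setoid := RingSetoid {
  rs_car : Type;
  rs_eq : rs_car -> rs_car -> Prop;
  rs0 : rs_car;
  rs1 : rs_car;
  rsN : rs_car -> rs_car;
  rsD : rs_car -> rs_car -> rs_car;
  rsM : rs_car -> rs_car -> rs_car;
  rs_refl : forall x, rs_eq x x;
  rs_sym : forall x y, rs_eq x y -> rs_eq y x;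
  rs_trans : forall x y z, rs_eq x y -> rs_eq y z -> rs_eq x z;
  rsN_eq : forall x x', rs_eq x x' -> rs_eq (rsN x) (rsN x');
  rsD_eq : forall x x' y y',
    rs_eq x x' -> rs_eq y y' -> rs_eq (rsD x y) (rsD x' y');
  rsM_eq : forall x x' y y',
    rs_eq x x' -> rs_eq y y' -> rs_eq (rsM x y) (rsM x' y');
  rs_addA : forall x y z, rs_eq (rsD x (rsD y z)) (rsD (rsD x y) z);
  rs_addC : forall x y, rs_eq (rsD x y) (rsD y x);
  rs_add0 : forall x, rs_eq (rsD rs0 x) x;
  rs_addN : forall x, rs_eq (rsD (rsN x) x) rs0;
  rs_mulA : forall x y z, rs_eq (rsM x (rsM y z)) (rsM (rsM x y) z);
  rs_mulC : forall x y, rs_eq (rsM x y) (rsM y x);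
  rs_mul1 : forall x, rs_eq (rsM rs1 x) x;
  rs_mulD : forall x y z, rs_eq (rsM (rsD x y) z) (rsD (rsM x z) (rsM y z)) }.

Section SetoidQuotient.
Local Open Scope quotient_scope.
Variable S : ring_setoid.

Definition rs_rel (x y : {classic (rs_car S)}) : bool := `[< rs_eq x y >].

Let rs_rel_refl : reflexive rs_rel.
Proof. by move=> x; apply/asboolP/rs_refl. Qed.
Let rs_rel_sym : symmetric rs_rel.
Proof. by move=> x y; apply/asboolP/asboolP => /rs_sym. Qed.
Let rs_rel_trans : transitive rs_rel.
Proof. by move=> y x z /asboolP xy /asboolP yz; apply/asboolP/(rs_trans xy). Qed.

Canonical rs_equiv := EquivRel rs_rel rs_rel_refl rs_rel_sym rs_rel_trans.

Definition rs_quot := {eq_quot rs_equiv}.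
HB.instance Definition _ := Choice.on rs_quot.

Definition rs_pi (x : rs_car S) : rs_quot := \pi_rs_quot (x : {classic (rs_car S)}).
Definition rs_repr (a : rs_quot) : rs_car S := repr a.

Lemma rs_piP x y : rs_pi x = rs_pi y <-> rs_eq x y.
Proof. by split=> [/eqmodP/asboolP|xy]; last exact/eqmodP/asboolP. Qed.

Lemma rs_reprK a : rs_pi (rs_repr a) = a. Proof. exact: reprK. Qed.

Lemma rs_repr_pi x : rs_eq (rs_repr (rs_pi x)) x.
Proof. by apply/rs_piP; rewrite rs_reprK. Qed.

Lemma rs_quotW (P : rs_quot -> Prop) : (forall x, P (rs_pi x)) -> forall a, P a.
Proof. by move=> Px a; rewrite -(rs_reprK a). Qed.

Definition rsq_opp a := rs_pi (rsN (rs_repr a)).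
Definition rsq_add a b := rs_pi (rsD (rs_repr a) (rs_repr b)).
Definition rsq_mul a b := rs_pi (rsM (rs_repr a) (rs_repr b)).

Let oppE x : rsq_opp (rs_pi x) = rs_pi (rsN x).
Proof. exact/rs_piP/rsN_eq/rs_repr_pi. Qed.
Let addE x y : rsq_add (rs_pi x) (rs_pi y) = rs_pi (rsD x y).
Proof. by apply/rs_piP/rsD_eq; apply: rs_repr_pi. Qed.
Let mulE x y : rsq_mul (rs_pi x) (rs_pi y) = rs_pi (rsM x y).
Proof. by apply/rs_piP/rsM_eq; apply: rs_repr_pi. Qed.

Let addA : associative rsq_add.
Proof.
elim/rs_quotW=> x; elim/rs_quotW=> y; elim/rs_quotW=> z.
by rewrite !addE; apply/rs_piP/rs_addA.
Qed.
Let addC : commutative rsq_add.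
Proof.
by elim/rs_quotW=> x; elim/rs_quotW=> y; rewrite !addE; apply/rs_piP/rs_addC.
Qed.
Let add0 : left_id (rs_pi (rs0 S)) rsq_add.
Proof. by elim/rs_quotW=> x; rewrite addE; apply/rs_piP/rs_add0. Qed.
Let addN : left_inverse (rs_pi (rs0 S)) rsq_opp rsq_add.
Proof. by elim/rs_quotW=> x; rewrite oppE addE; apply/rs_piP/rs_addN. Qed.
Let mulA : associative rsq_mul.
Proof.
elim/rs_quotW=> x; elim/rs_quotW=> y; elim/rs_quotW=> z.
by rewrite !mulE; apply/rs_piP/rs_mulA.
Qed.
Let mulC : commutative rsq_mul.
Proof.
by elim/rs_quotW=> x; elim/rs_quotW=> y; rewrite !mulE; apply/rs_piP/rs_mulC.
Qed.
Let mul1 : left_id (rs_pi (rs1 S)) rsq_mul.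
Proof. by elim/rs_quotW=> x; rewrite mulE; apply/rs_piP/rs_mul1. Qed.
Let mulD : left_distributive rsq_mul rsq_add.
Proof.
elim/rs_quotW=> x; elim/rs_quotW=> y; elim/rs_quotW=> z.
by rewrite !(addE, mulE); apply/rs_piP/rs_mulD.
Qed.

HB.instance Definition _ := GRing.isZmodule.Build rs_quot addA addC add0 addN.
HB.instance Definition _ :=
  GRing.Zmodule_isComPzRing.Build rs_quot mulA mulC mul1 mulD.

Lemma rs_pi0 : rs_pi (rs0 S) = 0. Proof. by []. Qed.
Lemma rs_pi1 : rs_pi (rs1 S) = 1. Proof. by []. Qed.
Lemma rs_piN x : rs_pi (rsN x) = - rs_pi x. Proof. by rewrite -oppE. Qed.
Lemma rs_piD x y : rs_pi (rsD x y) = rs_pi x + rs_pi y.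
Proof. by rewrite -addE. Qed.
Lemma rs_piM x y : rs_pi (rsM x y) = rs_pi x * rs_pi y.
Proof. by rewrite -mulE. Qed.

End SetoidQuotient.

Record ring_setoid_hom (S T : ring_setoid) := RingSetoidHom {
  rsh_fun :> rs_car S -> rs_car T;
  rsh_eq : forall x y, rs_eq x y -> rs_eq (rsh_fun x) (rsh_fun y);
  rsh_add : forall x y,
    rs_eq (rsh_fun (rsD x y)) (rsD (rsh_fun x) (rsh_fun y));
  rsh_mul : forall x y,
    rs_eq (rsh_fun (rsM x y)) (rsM (rsh_fun x) (rsh_fun y));
  rsh_one : rs_eq (rsh_fun (rs1 S)) (rs1 T) }.

Section SetoidHom.
Variables (S T : ring_setoid) (f : ring_setoid_hom S T).

Definition rs_lift (a : rs_quot S) : rs_quot T := rs_pi (f (rs_repr a)).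

Lemma rs_liftE x : rs_lift (rs_pi x) = rs_pi (f x).
Proof. exact/rs_piP/rsh_eq/rs_repr_pi. Qed.

Let liftD : {morph rs_lift : a b / a + b}.
Proof.
elim/rs_quotW=> x; elim/rs_quotW=> y.
by rewrite -rs_piD !rs_liftE -rs_piD; apply/rs_piP/rsh_add.
Qed.
Let liftB : zmod_morphism rs_lift.
Proof.
move=> a b; apply: (@addIr _ (rs_lift b)).
by rewrite -liftD !subrK.
Qed.
Let liftM : monoid_morphism rs_lift.
Proof.
split; first by rewrite -rs_pi1 rs_liftE; apply/rs_piP/rsh_one.
elim/rs_quotW=> x; elim/rs_quotW=> y.
by rewrite -rs_piM !rs_liftE -rs_piM; apply/rs_piP/rsh_mul.
Qed.

HB.instance Definition _ :=
  GRing.isZmodMorphism.Build (rs_quot S) (rs_quot T) rs_lift liftB.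
HB.instance Definition _ :=
  GRing.isMonoidMorphism.Build (rs_quot S) (rs_quot T) rs_lift liftM.

End SetoidHom.

(** * Topologically ringed spaces *)

Identity Coercion set_to_fun : set >-> Funclass.

Record opens (X : topologicalType) := Opens {
  opens_set :> set X;
  opens_open : open opens_set }.

Definition opensT (X : topologicalType) : opens X := Opens (@openT X).

Definition opensI (X : topologicalType) (U V : opens X) : opens X :=
  Opens (openI (opens_open U) (opens_open V)).

Lemma opensIl (X : topologicalType) (U V : opens X) : opensI U V `<=` U.
Proof. exact: subIsetl. Qed.

Lemma opensIr (X : topologicalType) (U V : opens X) : opensI U V `<=` V.
Proof. exact: subIsetr. Qed.

Lemma preopen_proof (X Y : topologicalType) (f : X -> Y) :
  continuous f -> forall V : opens Y, open (f @^-1` V).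
Proof. by move=> /continuousP fc V; apply/fc/opens_open. Qed.

Definition preopen (X Y : topologicalType) (f : X -> Y) (fc : continuous f)
  (V : opens Y) : opens X := Opens (preopen_proof fc V).

Lemma preopenS (X Y : topologicalType) (f : X -> Y) (fc : continuous f)
  (V W : opens Y) : V `<=` W -> preopen fc V `<=` preopen fc W.
Proof. by move=> VW x; apply: VW. Qed.
Arguments preopenS {X Y f} fc {V W} _.

(* [tr_top] says that the topology on the sections over the union of the V_i
   is the initial one for the restrictions to the V_i, so that the sheaf
   property holds in topological rings. *)
Record topRingedSpace := TopRingedSpace {
  tr_space :> topologicalType;
  sect : opens tr_space -> topComPzRingType;
  res : forall U V : opens tr_space, V `<=` U -> {rmorphism sect U -> sect V};
  res_continuous : forall (U V : opens tr_space) (VU : V `<=` U), continuous (res VU);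
  res_id : forall (U : opens tr_space) (UU : U `<=` U) (s : sect U), res UU s = s;
  res_comp : forall (U V W : opens tr_space)
    (VU : V `<=` U) (WV : W `<=` V) (WU : W `<=` U)
    (s : sect U), res WV (res VU s) = res WU s;
  tr_local : forall (U : opens tr_space) (I : Type) (V : I -> opens tr_space)
    (VU : forall i, V i `<=` U), U `<=` \bigcup_i V i ->
    forall s t : sect U, (forall i, res (VU i) s = res (VU i) t) -> s = t;
  tr_glue : forall (U : opens tr_space) (I : Type) (V : I -> opens tr_space)
    (VU : forall i, V i `<=` U), U `<=` \bigcup_i V i ->
    forall s : (forall i, sect (V i)),
    (forall i j (W : opens tr_space) (Wi : W `<=` V i) (Wj : W `<=` V j),
       res Wi (s i) = res Wj (s j)) ->
    exists t : sect U, forall i, res (VU i) t = s i;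
  tr_top : forall (U : opens tr_space) (I : Type) (V : I -> opens tr_space)
    (VU : forall i, V i `<=` U), U `<=` \bigcup_i V i ->
    forall (F : set_system (sect U)) (s : sect U), Filter F ->
    (forall i, res (VU i) @ F --> res (VU i) s) -> F --> s }.

Record tr_morphism (X Y : topRingedSpace) := TrMorphism {
  tr_fun :> X -> Y;
  tr_continuous : continuous tr_fun;
  sharp : forall V : opens Y, {rmorphism sect V -> sect (preopen tr_continuous V)};
  sharp_continuous : forall V, continuous (sharp V);
  sharp_res : forall (V W : opens Y) (WV : W `<=` V) (s : sect V),
    sharp W (res WV s) = res (preopenS tr_continuous WV) (sharp V s) }.

Section Stalk.
Variables (X : topRingedSpace) (x : X).

Record germ_rep := GermRep {
  gr_dom : opens X;
  gr_in : gr_dom x;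
  gr_sec : sect gr_dom }.
Implicit Types g h : germ_rep.

Definition germ_eq g h := exists (W : opens X)
  (Wg : W `<=` gr_dom g) (Wh : W `<=` gr_dom h),
  W x /\ res Wg (gr_sec g) = res Wh (gr_sec h).

Definition germ_op (op : forall A : topComPzRingType, A -> A -> A) g h :=
  @GermRep (opensI (gr_dom g) (gr_dom h)) (conj (gr_in g) (gr_in h))
    (op _ (res (@opensIl _ _ _) (gr_sec g)) (res (@opensIr _ _ _) (gr_sec h))).

Definition germD := germ_op (fun A => @GRing.add A).
Definition germM := germ_op (fun A => @GRing.mul A).
Definition germN g := GermRep (gr_in g) (- gr_sec g).
Definition germ0 := @GermRep (opensT X) I 0.
Definition germ1 := @GermRep (opensT X) I 1.

Let resS (U V W : opens X) (VU : V `<=` U) (WV : W `<=` V) (s : sect U) :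
  res WV (res VU s) = res (subset_trans WV VU) s.
Proof. exact: res_comp. Qed.

Let res_irr (U V : opens X) (h k : V `<=` U) (s : sect U) : res h s = res k s.
Proof. by rewrite (Prop_irrelevance h k). Qed.

Let germ_refl g : germ_eq g g.
Proof. by exists (gr_dom g), (@subset_refl _ _), (@subset_refl _ _); split=> //; case: g. Qed.

Let germ_sym g h : germ_eq g h -> germ_eq h g.
Proof. by move=> [W [Wg [Wh [Wx E]]]]; exists W, Wh, Wg. Qed.

Let germ_trans g h k : germ_eq g h -> germ_eq h k -> germ_eq g k.
Proof.
move=> [W [Wg [Wh [Wx E]]]] [V [Vh [Vk [Vx E']]]].
have WI : opensI W V `<=` W by move=> y [].
have VI : opensI W V `<=` V by move=> y [].
exists (opensI W V), (subset_trans WI Wg), (subset_trans VI Vk).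
split=> //; rewrite -!resS E -E' !resS; exact: res_irr.
Qed.

Let germN_eq g g' : germ_eq g g' -> germ_eq (germN g) (germN g').
Proof.
move=> [W [Wg [Wh [Wx E]]]]; exists W, Wg, Wh; split=> //=.
by rewrite !rmorphN E.
Qed.

Let germD_eq g g' h h' :
  germ_eq g g' -> germ_eq h h' -> germ_eq (germD g h) (germD g' h').
Proof.
move=> [W [Wg [Wg' [Wx E]]]] [V [Vh [Vh' [Vx E']]]].
have WI : opensI W V `<=` W by move=> y [].
have VI : opensI W V `<=` V by move=> y [].
exists (opensI W V), (setISS Wg Vh), (setISS Wg' Vh').
split=> //=; rewrite !rmorphD !resS /=.
have := congr1 (res WI) E; have := congr1 (res VI) E'; rewrite !resS => e' e.
congr (_ + _).
  by rewrite (res_irr _ (subset_trans WI Wg)) e; exact: res_irr.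
by rewrite (res_irr _ (subset_trans VI Vh)) e'; exact: res_irr.
Qed.

Let germM_eq g g' h h' :
  germ_eq g g' -> germ_eq h h' -> germ_eq (germM g h) (germM g' h').
Proof.
move=> [W [Wg [Wg' [Wx E]]]] [V [Vh [Vh' [Vx E']]]].
have WI : opensI W V `<=` W by move=> y [].
have VI : opensI W V `<=` V by move=> y [].
exists (opensI W V), (setISS Wg Vh), (setISS Wg' Vh').
split=> //=; rewrite !rmorphM !resS /=.
have := congr1 (res WI) E; have := congr1 (res VI) E'; rewrite !resS => e' e.
congr (_ * _).
  by rewrite (res_irr _ (subset_trans WI Wg)) e; exact: res_irr.
by rewrite (res_irr _ (subset_trans VI Vh)) e'; exact: res_irr.
Qed.

Let germ_addA g h k : germ_eq (germD g (germD h k)) (germD (germD g h) k).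
Proof.
have [gh hk] : gr_dom (germD g (germD h k)) `<=` gr_dom (germD g (germD h k)) /\
  gr_dom (germD g (germD h k)) `<=` gr_dom (germD (germD g h) k).
  by split=> y //= [? []].
exists _, gh, hk; split; first by do !split; apply: gr_in.
rewrite /= !rmorphD /= !resS addrA.
by congr (_ + _ + _); exact: res_irr.
Qed.

Let germ_addC g h : germ_eq (germD g h) (germD h g).
Proof.
have hg : gr_dom (germD g h) `<=` gr_dom (germD h g) by move=> y [].
exists _, (@subset_refl _ _), hg; split; first by split; apply: gr_in.
by rewrite /= !rmorphD /= !resS addrC; congr (_ + _); exact: res_irr.
Qed.

Let germ_add0 g : germ_eq (germD germ0 g) g.
Proof.
have Wg : gr_dom (germD germ0 g) `<=` gr_dom g by move=> y [].
exists _, (@subset_refl _ _), Wg; split; first by split=> //; apply: gr_in.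
by rewrite /= !rmorphD /= !resS rmorph0 add0r; exact: res_irr.
Qed.

Let germ_addN g : germ_eq (germD (germN g) g) germ0.
Proof.
have Wg : gr_dom (germD (germN g) g) `<=` gr_dom germ0 by [].
exists _, (@subset_refl _ _), Wg; split; first by split=> //=; apply: gr_in.
rewrite /= !rmorphD /= !resS rmorph0 rmorphN; apply/eqP.
by rewrite addrC subr_eq0; apply/eqP; exact: res_irr.
Qed.

Let germ_mulA g h k : germ_eq (germM g (germM h k)) (germM (germM g h) k).
Proof.
have [gh hk] : gr_dom (germM g (germM h k)) `<=` gr_dom (germM g (germM h k)) /\
  gr_dom (germM g (germM h k)) `<=` gr_dom (germM (germM g h) k).
  by split=> y //= [? []].
exists _, gh, hk; split; first by do !split; apply: gr_in.
rewrite /= !rmorphM /= !resS mulrA.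
by congr (_ * _ * _); exact: res_irr.
Qed.

Let germ_mulC g h : germ_eq (germM g h) (germM h g).
Proof.
have hg : gr_dom (germM g h) `<=` gr_dom (germM h g) by move=> y [].
exists _, (@subset_refl _ _), hg; split; first by split; apply: gr_in.
by rewrite /= !rmorphM /= !resS mulrC; congr (_ * _); exact: res_irr.
Qed.

Let germ_mul1 g : germ_eq (germM germ1 g) g.
Proof.
have Wg : gr_dom (germM germ1 g) `<=` gr_dom g by move=> y [].
exists _, (@subset_refl _ _), Wg; split; first by split=> //; apply: gr_in.
by rewrite /= !rmorphM /= !resS rmorph1 mul1r; exact: res_irr.
Qed.

Let germ_mulD g h k :
  germ_eq (germM (germD g h) k) (germD (germM g k) (germM h k)).
Proof.
have Wg : gr_dom (germM (germD g h) k) `<=` gr_dom (germD (germM g k) (germM h k)).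
  by move=> y [[? ?] ?]; split; split.
exists _, (@subset_refl _ _), Wg; split; first by do !split; apply: gr_in.
rewrite /= rmorphD !rmorphM /= !rmorphD /= mulrDl !resS.
by congr (_ + _); rewrite rmorphM !resS; congr (_ * _); exact: res_irr.
Qed.

Definition germ_setoid : ring_setoid :=
  RingSetoid germ_refl germ_sym germ_trans germN_eq germD_eq germM_eq
    germ_addA germ_addC germ_add0 germ_addN germ_mulA germ_mulC germ_mul1
    germ_mulD.

Definition stalk : comPzRingType := rs_quot germ_setoid.

Definition germ (U : opens X) (Ux : U x) (s : sect U) : stalk :=
  @rs_pi germ_setoid (GermRep Ux s).

End Stalk.

Section StalkMap.
Variables (X Y : topRingedSpace) (f : tr_morphism X Y) (x : X).

Let germ_pull (g : germ_rep (f x)) : germ_rep x :=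
  @GermRep _ x (preopen (@tr_continuous _ _ f) (gr_dom g)) (gr_in g)
    (sharp f _ (gr_sec g)).

Let germ_pull_eq g h : germ_eq g h -> germ_eq (germ_pull g) (germ_pull h).
Proof.
move=> [W [Wg [Wh [Wx E]]]].
exists (preopen (@tr_continuous _ _ f) W), (preopenS _ Wg), (preopenS _ Wh).
by split=> //=; rewrite -!sharp_res E.
Qed.

Let germ_pullD g h :
  germ_eq (germ_pull (germD g h)) (germD (germ_pull g) (germ_pull h)).
Proof.
exists (gr_dom (germ_pull (germD g h))), (@subset_refl _ _), (@subset_refl _ _).
split; first by split; apply: gr_in.
rewrite res_id /= rmorphD !sharp_res [RHS]rmorphD.
by congr (_ + _); symmetry; apply: res_comp.
Qed.

Let germ_pullM g h :
  germ_eq (germ_pull (germM g h)) (germM (germ_pull g) (germ_pull h)).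
Proof.
exists (gr_dom (germ_pull (germM g h))), (@subset_refl _ _), (@subset_refl _ _).
split; first by split; apply: gr_in.
rewrite res_id /= rmorphM !sharp_res [RHS]rmorphM.
by congr (_ * _); symmetry; apply: res_comp.
Qed.

Let germ_pull1 : germ_eq (germ_pull (germ1 (f x))) (germ1 x).
Proof.
have T : gr_dom (germ_pull (germ1 (f x))) `<=` gr_dom (germ1 x) by [].
by exists _, (@subset_refl _ _), T; split=> //=; rewrite !rmorph1.
Qed.

Definition stalk_map : {rmorphism stalk (f x) -> stalk x} :=
  rs_lift (@RingSetoidHom (germ_setoid (f x)) (germ_setoid x) germ_pull
    germ_pull_eq germ_pullD germ_pullM germ_pull1).

Lemma stalk_map_germ (V : opens Y) (Vfx : V (f x)) (s : sect V) :
  stalk_map (germ Vfx s) =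
  @germ _ x (preopen (@tr_continuous _ _ f) V) Vfx (sharp f V s).
Proof. exact: rs_liftE. Qed.

End StalkMap.

Definition local_on_stalks (X Y : topRingedSpace) (f : tr_morphism X Y) :=
  forall (x : X) (a : stalk (f x)), is_unit (stalk_map f x a) -> is_unit a.

(** * Admissible rings *)

Section Admissible.
Variable R : topComPzRingType.
Implicit Types a : set R.

Definition open_ideal a := is_ideal a /\ open a.

Definition linearly_topologized :=
  forall U : set R, nbhs 0 U -> exists2 a, open_ideal a & a `<=` U.

Definition topologically_nilpotent a :=
  forall b, open_ideal b -> exists n, idealX a n `<=` b.

Definition ideal_of_definition a := open_ideal a /\ topologically_nilpotent a.

Definition fundamental_open_ideals (L : set (set R)) :=
  L `<=` open_ideal /\
  forall U : set R, nbhs 0 U -> exists2 a, L a & a `<=` U.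

(* R -> lim R/a, for a in L, is bijective; an element of the limit is given by
   representatives [r a] of its components. *)
Definition complete_wrt (L : set (set R)) :=
  (forall x, (forall a, L a -> a x) -> x = 0) /\
  (forall r : set R -> R,
     (forall a b, L a -> L b -> a `<=` b -> b (r a - r b)) ->
     exists x, forall a, L a -> a (x - r a)).

Definition complete_ring :=
  exists2 L, fundamental_open_ideals L & complete_wrt L.

Definition admissible :=
  [/\ linearly_topologized, complete_ring & exists a, ideal_of_definition a].

Definition adic :=
  complete_ring /\
  exists2 a, ideal_of_definition a &
    fundamental_open_ideals [set idealX a n | n in setT].

End Admissible.

Record admissibleRing := AdmissibleRing {
  adm_ring :> topComPzRingType;
  adm_ringP : admissible adm_ring }.

(** * Formal spectra *)

Record spec (A : comPzRingType) := Spec {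
  spec_ideal :> set A;
  spec_prime : is_prime spec_ideal }.

HB.instance Definition _ (A : comPzRingType) := gen_eqMixin (spec A).
HB.instance Definition _ (A : comPzRingType) := gen_choiceMixin (spec A).

Section Zariski.
Variable A : comPzRingType.

Definition zariski_open (U : set (spec A)) :=
  exists E : set A, U = ~` [set p : spec A | E `<=` p].

Let notsub (E F : set A) : ~ (E `<=` F) <-> exists2 x, E x & ~ F x.
Proof.
split=> [EF|[x Ex Fx] /(_ x Ex)//].
apply: contrapT => h; apply: EF => x Ex; apply: contrapT => Fx.
by apply: h; exists x.
Qed.

Let zariskiT : zariski_open setT.
Proof.
exists setT; apply/seteqP; split=> // p _ /= T.
by case: (spec_prime p) => _ /(_ (T 1 I)).
Qed.

Let zariskiI : setI_closed zariski_open.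
Proof.
move=> _ _ [E ->] [F ->].
exists [set z | exists x y, [/\ E x, F y & z = x * y]].
apply/seteqP; split=> [p [/= /notsub[x Ex px] /notsub[y Fy py]]|p].
  case: (spec_prime p) => _ _ pp sub.
  by have /pp[] : p (x * y) by apply: sub; exists x, y.
case: (spec_prime p) => -[_ _ pM] _ _ /= /notsub [_ [x [y [Ex Fy ->]]] pxy].
split=> /= [/(_ _ Ex) px|/(_ _ Fy) py]; apply: pxy; last exact: pM.
by rewrite mulrC; exact: pM.
Qed.

Let zariskiU (I : Type) (f : I -> set (spec A)) :
  (forall i, zariski_open (f i)) -> zariski_open (\bigcup_i f i).
Proof.
move=> /choice [E fE]; exists (\bigcup_i E i); apply/seteqP; split=> p.
  move=> [i _]; rewrite fE /= => /notsub [x Ex px] sub.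
  by apply: px; apply: sub; exists i.
by move=> /= /notsub [x [i _ Ex] px]; exists i => //; rewrite fE => /(_ x Ex).
Qed.

HB.instance Definition _ :=
  isOpenTopological.Build (spec A) zariskiT zariskiI zariskiU.

End Zariski.

Record ideal (A : comPzRingType) := Ideal {
  ideal_set :> set A;
  idealP : is_ideal ideal_set }.

(* The local ring at p/a of A/a. Fractions have numerator and denominator in A
   and x/s = y/t when u(xt - ys) lies in a for some u outside p. *)
Section LocalRing.
Variables (A : comPzRingType) (a : ideal A) (p : spec A).

Record frac_rep := FracRep {
  fr_num : A;
  fr_den : A;
  fr_denP : ~ p fr_den }.
Implicit Types x y z : frac_rep.

Definition frac_eq x y := exists2 u, ~ p u &
  a (u * (fr_num x * fr_den y - fr_num y * fr_den x)).

Let p1 : ~ p 1. Proof. by case: (spec_prime p). Qed.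

Let pM s t : ~ p s -> ~ p t -> ~ p (s * t).
Proof. by case: (spec_prime p) => _ _ pM ps pt /pM []. Qed.

Let a0 : a 0. Proof. by case: (idealP a). Qed.
Let aD (x y : A) : a x -> a y -> a (x + y).
Proof. by case: (idealP a) => _ + _; apply. Qed.
Let aM (r x : A) : a x -> a (r * x).
Proof. by case: (idealP a) => _ _; apply. Qed.

Definition fracD x y :=
  FracRep (fr_num x * fr_den y + fr_num y * fr_den x)
    (pM (@fr_denP x) (@fr_denP y)).
Definition fracM x y :=
  FracRep (fr_num x * fr_num y) (pM (@fr_denP x) (@fr_denP y)).
Definition fracN x := FracRep (- fr_num x) (@fr_denP x).
Definition frac0 := FracRep 0 p1.
Definition frac1 := FracRep 1 p1.

Lemma frac_eqE x y : fr_num x * fr_den y = fr_num y * fr_den x -> frac_eq x y.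
Proof. by move=> E; exists 1 => //; rewrite E subrr mulr0. Qed.

Let frac_refl x : frac_eq x x. Proof. exact: frac_eqE. Qed.

Let frac_sym x y : frac_eq x y -> frac_eq y x.
Proof.
move=> [u pu xy]; exists u => //.
by move: (aM (-1) xy); congr (ideal_set a _); ring.
Qed.

Let frac_trans x y z : frac_eq x y -> frac_eq y z -> frac_eq x z.
Proof.
move=> [u pu xy] [v pv yz]; exists (u * v * fr_den y).
  by apply: pM; [exact: pM|exact: fr_denP].
move: (aD (aM (v * fr_den z) xy) (aM (u * fr_den x) yz)).
by congr (ideal_set a _); ring.
Qed.

Let fracN_eq x x' : frac_eq x x' -> frac_eq (fracN x) (fracN x').
Proof.
move=> [u pu xy]; exists u => //=.
by move: (aM (-1) xy); congr (ideal_set a _); ring.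
Qed.

Let fracD_eq x x' y y' :
  frac_eq x x' -> frac_eq y y' -> frac_eq (fracD x y) (fracD x' y').
Proof.
move=> [u pu xy] [v pv yz]; exists (u * v); first exact: pM.
move: (aD (aM (v * fr_den y * fr_den y') xy) (aM (u * fr_den x * fr_den x') yz)).
by congr (ideal_set a _) => /=; ring.
Qed.

Let fracM_eq x x' y y' :
  frac_eq x x' -> frac_eq y y' -> frac_eq (fracM x y) (fracM x' y').
Proof.
move=> [u pu xy] [v pv yz]; exists (u * v); first exact: pM.
move: (aD (aM (v * fr_num y * fr_den y') xy) (aM (u * fr_num x' * fr_den x) yz)).
by congr (ideal_set a _) => /=; ring.
Qed.

Let frac_addA x y z : frac_eq (fracD x (fracD y z)) (fracD (fracD x y) z).
Proof. by apply: frac_eqE => /=; ring. Qed.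
Let frac_addC x y : frac_eq (fracD x y) (fracD y x).
Proof. by apply: frac_eqE => /=; ring. Qed.
Let frac_add0 x : frac_eq (fracD frac0 x) x.
Proof. by apply: frac_eqE => /=; ring. Qed.
Let frac_addN x : frac_eq (fracD (fracN x) x) frac0.
Proof. by apply: frac_eqE => /=; ring. Qed.
Let frac_mulA x y z : frac_eq (fracM x (fracM y z)) (fracM (fracM x y) z).
Proof. by apply: frac_eqE => /=; ring. Qed.
Let frac_mulC x y : frac_eq (fracM x y) (fracM y x).
Proof. by apply: frac_eqE => /=; ring. Qed.
Let frac_mul1 x : frac_eq (fracM frac1 x) x.
Proof. by apply: frac_eqE => /=; ring. Qed.
Let frac_mulD x y z :
  frac_eq (fracM (fracD x y) z) (fracD (fracM x z) (fracM y z)).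
Proof. by apply: frac_eqE => /=; ring. Qed.

Definition frac_setoid : ring_setoid :=
  RingSetoid frac_refl frac_sym frac_trans fracN_eq fracD_eq fracM_eq
    frac_addA frac_addC frac_add0 frac_addN frac_mulA frac_mulC frac_mul1
    frac_mulD.

Definition local_ring : comPzRingType := rs_quot frac_setoid.

Definition fraction (x s : A) (ps : ~ p s) : local_ring :=
  @rs_pi frac_setoid (FracRep x ps).

End LocalRing.

Section LocalRingMap.
Variables (A : comPzRingType) (a b : ideal A) (p : spec A).
Hypothesis ab : a `<=` b.

Let frac_incl_eq (x y : frac_rep p) : frac_eq a x y -> frac_eq b x y.
Proof. by move=> [u pu /ab]; exists u. Qed.

Let frac_incl : ring_setoid_hom (frac_setoid a p) (frac_setoid b p) :=
  @RingSetoidHom (frac_setoid a p) (frac_setoid b p) id frac_incl_eq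
    (fun x y => @rs_refl (frac_setoid b p) (fracD x y))
    (fun x y => @rs_refl (frac_setoid b p) (fracM x y))
    (@rs_refl (frac_setoid b p) (frac1 p)).

Definition local_ring_map : {rmorphism local_ring a p -> local_ring b p} :=
  rs_lift frac_incl.

Lemma local_ring_map_fraction (x s : A) (ps : ~ p s) :
  local_ring_map (fraction a x ps) = fraction b x ps.
Proof. exact: rs_liftE. Qed.

End LocalRingMap.

(* Spf R, as a subspace of Spec R. *)
Record spf (R : topComPzRingType) := SpfPoint {
  spf_spec :> spec R;
  spf_open : open spf_spec }.

HB.instance Definition _ (R : topComPzRingType) := gen_eqMixin (spf R).
HB.instance Definition _ (R : topComPzRingType) := gen_choiceMixin (spf R).
HB.instance Definition _ (R : topComPzRingType) :=
  Topological.copy (spf R) (initial_topology (@spf_spec R)).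

Record idef (R : topComPzRingType) := Idef {
  idef_ideal :> ideal R;
  idefP : ideal_of_definition idef_ideal }.

Section SpfTopology.
Variable R : topComPzRingType.

Definition basic_open (f : R) : set (spf R) := [set p : spf R | ~ p f].

Lemma basic_open_open f : open (basic_open f).
Proof.
exists (~` [set p : spec R | [set f] `<=` p]); first by exists [set f].
apply/seteqP; split=> p /= pf; first by move=> h; apply: pf => _ ->.
by move=> sub; apply: pf; exact: sub.
Qed.

Lemma basic_open_nbhs (p : spf R) (U : set (spf R)) :
  nbhs p U -> exists f, basic_open f p /\ basic_open f `<=` U.
Proof.
rewrite nbhsE => -[_ [[_ [E ->] <-] /= Ep] sub].
have [x Ex px] : exists2 x, E x & ~ p x.
  apply: contrapT => h; apply: Ep => x Ex; apply: contrapT => px.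
  by apply: h; exists x.
by exists x; split=> // q qx; apply: sub => /= /(_ _ Ex).
Qed.

Lemma prime_idealX (p : spec R) (a : set R) n : idealX a n `<=` p -> a `<=` p.
Proof.
case: (spec_prime p) => _ p1 pP; elim: n => [|n IHn] /= sub.
  by case: p1; exact: sub.
apply: contrapT => ap; apply: (ap); apply: IHn => y yn.
have [x ax px] : exists2 x, a x & ~ p x.
  apply: contrapT => h; apply: ap => x ax; apply: contrapT => px.
  by apply: h; exists x.
have /pP[|//] : p (x * y); last by [].
by apply: sub; exists 1%N, (fun=> x), (fun=> y); split=> //; rewrite big_ord1.
Qed.

Lemma idealX_sub (a b : set R) n : a `<=` b -> idealX a n `<=` idealX b n.
Proof.
move=> ab; elim: n => //= n IHn x [m [u [v [au av ->]]]].
by exists m, u, v; split=> // i; [exact: ab|exact: IHn].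
Qed.

Lemma idef_sub_spf (a : idef R) (p : spf R) : a `<=` p.
Proof.
case: (idefP a) => _ /(_ p) []; last by move=> n; exact: prime_idealX.
by split; [case: (spec_prime p)|exact: spf_open].
Qed.

Lemma ideal_of_definitionI (a b : set R) :
  ideal_of_definition a -> ideal_of_definition b ->
  ideal_of_definition (a `&` b).
Proof.
move=> [[[a0 aD aM] oa] na] [[[b0 bD bM] ob] _]; split; last first.
  move=> c /na [n nc]; exists n; apply: subset_trans nc; apply: idealX_sub.
  exact: subIsetl.
split; last exact: openI.
split=> // [x y [? ?] [? ?]|r x [? ?]]; split.
- exact: aD.
- exact: bD.
- exact: aM.
- exact: bM.
Qed.

Definition idefI (a b : idef R) : idef R :=
  @Idef R (Ideal (ideal_of_definitionI (idefP a) (idefP b)).1.1)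
    (ideal_of_definitionI (idefP a) (idefP b)).

Lemma open_ideal_sup (a b : set R) : is_ideal b -> a 0 -> open a ->
  a `<=` b -> open b.
Proof.
move=> [b0 bD bM] a0 oa ab; rewrite openE => x bx.
have xa : nbhs x [set y | a (y - x)].
  have : (fun y => y - x) @ x --> x - x.
    apply: (@continuous_comp _ _ _ (fun y => (y, x)) (fun z => z.1 - z.2)).
      by apply: cvg_pair; [exact: cvg_id|exact: cvg_cst].
    exact: sub_continuous.
  by apply; rewrite subrr; apply: open_nbhs_nbhs.
by apply: filterS xa => y /ab byx; rewrite -(subrK x y); exact: bD.
Qed.

Lemma basic_open_compact (f : R) :
  (exists a : set R, ideal_of_definition a) -> compact (basic_open f).
Proof.
move=> [a aid]; rewrite compact_ultra => F FU Ff.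
pose P : set R := [set r | F [set q : spf R | q r]].
have qideal (q : spf R) : is_ideal q by case: (spec_prime q).
have Pid : is_ideal P.
  split=> [|x y Px Py|r x Px].
  - by apply: filterS filterT => q _; case: (qideal q).
  - apply: filterS (filterI Px Py) => q []; case: (qideal q) => _ qD _.
    exact: qD.
  - by apply: filterS Px => q; case: (qideal q) => _ _; apply.
have Pprime : is_prime P.
  split=> // [P1|x y Pxy].
    apply: (@filter_not_empty _ F _); apply: filterS P1 => q /=.
    by case: (spec_prime q).
  have [|nPx] := in_ultra_setVsetC [set q : spf R | q x] FU; first by left.
  right; apply: filterS (filterI Pxy nPx) => q [/= + qx].
  by case: (spec_prime q) => _ _ qP /qP[].
have Popen : open P.
  apply: (@open_ideal_sup a) => //.
  - by case: aid => -[[]].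
  - by case: aid => -[].
  - move=> x ax; apply: filterS filterT => q _.
    exact: (@idef_sub_spf (@Idef R (Ideal aid.1.1) aid)).
exists (@SpfPoint R (Spec Pprime) Popen); split=> /=.
  move=> Pf; apply: (@filter_not_empty _ F _).
  by apply: filterS (filterI Ff Pf) => q [].
move=> U /basic_open_nbhs [g [Pg gU]].
by have [//|] := in_ultra_setVsetC [set q : spf R | q g] FU; apply: filterS.
Qed.

End SpfTopology.

(* Sections over U of lim O_a, for a running through the ideals of definition
   and O_a the structure sheaf of Spec(R/a), whose underlying space is that of
   Spf R since an open prime contains every ideal of definition. *)
Section SpfSections.
Variables (R : admissibleRing) (U : opens (spf R)).

Record spf_sect := SpfSect {
  spf_val :> forall (a : idef R) (p : spf R), U p -> local_ring a p;
  spf_frac : forall (a : idef R) (p : spf R), U p ->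
    exists V : opens (spf R), V p /\
    exists x s : R, forall (q : spf R) (Uq : U q), V q ->
      exists qs : ~ q s, spf_val a Uq = fraction a x qs;
  spf_compat : forall (a b : idef R) (ab : a `<=` b) (p : spf R) (Up : U p),
    local_ring_map p ab (spf_val a Up) = spf_val b Up }.
Implicit Types s t : spf_sect.

Lemma spf_sectP s t : (forall a p (Up : U p), s a p Up = t a p Up) -> s = t.
Proof.
move: s t => [s sf sc] [t tf tc] /= st.
have {}st : s = t.
  by do 3![apply: functional_extensionality_dep => ?]; exact: st.
by subst t; congr SpfSect; apply: Prop_irrelevance.
Qed.


HB.instance Definition _ := gen_eqMixin spf_sect.
HB.instance Definition _ := gen_choiceMixin spf_sect.

Definition spf_zero : spf_sect.
Proof.
apply: (@SpfSect (fun a p _ => 0)) => [a p Up|a b ab p Up].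
  exists (opensT _); split=> //; exists 0, 1 => q Uq _.
  have q1 : ~ q 1 by case: (spec_prime q).
  by exists q1; rewrite -rs_pi0; apply/rs_piP/frac_eqE.
exact: rmorph0.
Defined.

Definition spf_one : spf_sect.
Proof.
apply: (@SpfSect (fun a p _ => 1)) => [a p Up|a b ab p Up].
  exists (opensT _); split=> //; exists 1, 1 => q Uq _.
  have q1 : ~ q 1 by case: (spec_prime q).
  by exists q1; rewrite -rs_pi1; apply/rs_piP/frac_eqE.
exact: rmorph1.
Defined.

Definition spf_opp s : spf_sect.
Proof.
apply: (@SpfSect (fun a p Up => - s a p Up)) => [a p Up|a b ab p Up].
  have [V [Vp [x [d sV]]]] := spf_frac s a Up.
  exists V; split=> //; exists (- x), d => q Uq Vq.
  have [qd ->] := sV q Uq Vq; exists qd.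
  by rewrite /fraction -rs_piN.
by rewrite rmorphN /= spf_compat.
Defined.

Definition spf_add s t : spf_sect.
Proof.
apply: (@SpfSect (fun a p Up => s a p Up + t a p Up)) => [a p Up|a b ab p Up].
  have [V [Vp [x [d sV]]]] := spf_frac s a Up.
  have [W [Wp [y [e tW]]]] := spf_frac t a Up.
  exists (opensI V W); split=> //; exists (x * e + y * d), (d * e).
  move=> q Uq [Vq Wq].
  have [qd ->] := sV q Uq Vq; have [qe ->] := tW q Uq Wq.
  have qde : ~ q (d * e) by case: (spec_prime q) => _ _ qP /qP[].
  by exists qde; rewrite /fraction -rs_piD; apply/rs_piP/frac_eqE.
by rewrite rmorphD /= !spf_compat.
Defined.

Definition spf_mul s t : spf_sect.
Proof.
apply: (@SpfSect (fun a p Up => s a p Up * t a p Up)) => [a p Up|a b ab p Up].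
  have [V [Vp [x [d sV]]]] := spf_frac s a Up.
  have [W [Wp [y [e tW]]]] := spf_frac t a Up.
  exists (opensI V W); split=> //; exists (x * y), (d * e).
  move=> q Uq [Vq Wq].
  have [qd ->] := sV q Uq Vq; have [qe ->] := tW q Uq Wq.
  have qde : ~ q (d * e) by case: (spec_prime q) => _ _ qP /qP[].
  by exists qde; rewrite /fraction -rs_piM; apply/rs_piP/frac_eqE.
by rewrite rmorphM /= !spf_compat.
Defined.

Let spf_addA : associative spf_add.
Proof. by move=> s t u; apply: spf_sectP => a p Up /=; exact: addrA. Qed.
Let spf_addC : commutative spf_add.
Proof. by move=> s t; apply: spf_sectP => a p Up /=; exact: addrC. Qed.
Let spf_add0 : left_id spf_zero spf_add.
Proof. by move=> s; apply: spf_sectP => a p Up /=; exact: add0r. Qed.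
Let spf_addN : left_inverse spf_zero spf_opp spf_add.
Proof. by move=> s; apply: spf_sectP => a p Up /=; exact: addNr. Qed.
Let spf_mulA : associative spf_mul.
Proof. by move=> s t u; apply: spf_sectP => a p Up /=; exact: mulrA. Qed.
Let spf_mulC : commutative spf_mul.
Proof. by move=> s t; apply: spf_sectP => a p Up /=; exact: mulrC. Qed.
Let spf_mul1 : left_id spf_one spf_mul.
Proof. by move=> s; apply: spf_sectP => a p Up /=; exact: mul1r. Qed.
Let spf_mulD : left_distributive spf_mul spf_add.
Proof. by move=> s t u; apply: spf_sectP => a p Up /=; exact: mulrDl. Qed.

HB.instance Definition _ :=
  GRing.isZmodule.Build spf_sect spf_addA spf_addC spf_add0 spf_addN.
HB.instance Definition _ :=
  GRing.Zmodule_isComPzRing.Build spf_sect spf_mulA spf_mulC spf_mul1 spf_mulD.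

(* O_a is a sheaf of pseudo-discrete rings: its sections are discrete over a
   quasi-compact open set. *)
Definition spf_agree (a : idef R) (K : set (spf R)) s t :=
  forall (p : spf R) (Up : U p), K p -> s a p Up = t a p Up.

Definition spf_nbhs s : set_system spf_sect :=
  [set B | exists (a : idef R) (K : opens (spf R)),
    [/\ compact K, K `<=` U & spf_agree a K s `<=` B]].

HB.instance Definition _ := hasNbhs.Build spf_sect spf_nbhs.

Let spf_nbhs_filter s : ProperFilter (spf_nbhs s).
Proof.
split.
  move=> [a [K [_ _ sub]]]; exact: (sub s).
split.
- have [_ _ [a aid]] := adm_ringP R.
  exists (@Idef R (Ideal aid.1.1) aid), (Opens open0).
  by split=> //; exact: compact0.
- move=> B C [a [K [cK KU aB]]] [b [L [cL LU bC]]].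
  exists (idefI a b), (Opens (openU (opens_open K) (opens_open L))).
  split; [exact: compactU|by rewrite subUset|].
  move=> t st; split; [apply: aB|apply: bC] => p Up ?.
  + have ab : idefI a b `<=` a by exact: subIsetl.
    by rewrite -!(spf_compat _ ab) st //; left.
  + have ab : idefI a b `<=` b by exact: subIsetr.
    by rewrite -!(spf_compat _ ab) st //; right.
- move=> B C BC [a [K [cK KU aB]]]; exists a, K; split=> //.
  exact: subset_trans BC.
Qed.

Let spf_nbhs_singleton s (B : set spf_sect) : spf_nbhs s B -> B s.
Proof. by move=> [a [K [_ _]]]; apply. Qed.

Let spf_nbhs_nbhs s (B : set spf_sect) :
  spf_nbhs s B -> spf_nbhs s (spf_nbhs^~ B).
Proof.
move=> [a [K [cK KU aB]]]; exists a, K; split=> // t st.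
exists a, K; split=> // u tu; apply: aB => p Up Kp.
by rewrite st // tu.
Qed.

HB.instance Definition _ := Nbhs_isNbhsTopological.Build spf_sect
  spf_nbhs_filter spf_nbhs_singleton spf_nbhs_nbhs.

Let spf_continuous2 (op : spf_sect -> spf_sect -> spf_sect) :
  (forall a K s s' t t', spf_agree a K s s' -> spf_agree a K t t' ->
     spf_agree a K (op s t) (op s' t')) ->
  continuous (fun z : spf_sect * spf_sect => op z.1 z.2).
Proof.
move=> opP [s t] B [a [K [cK KU aB]]].
exists (spf_agree a K s, spf_agree a K t).
  by split=> /=; exists a, K; split.
by move=> [s' t'] [/= ss' tt']; apply: aB; exact: opP.
Qed.

Let spf_add_continuous :
  continuous (fun z : spf_sect * spf_sect => z.1 + z.2).
Proof.
by apply: spf_continuous2 => a K s s' t t' ss' tt' p Up Kp /=; rewrite ss' ?tt'.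
Qed.

Let spf_mul_continuous :
  continuous (fun z : spf_sect * spf_sect => z.1 * z.2).
Proof.
by apply: spf_continuous2 => a K s s' t t' ss' tt' p Up Kp /=; rewrite ss' ?tt'.
Qed.

Let spf_opp_continuous : continuous (fun s : spf_sect => - s).
Proof.
move=> s B [a [K [cK KU aB]]]; exists a, K; split=> // t st.
by apply: aB => p Up Kp /=; rewrite st.
Qed.

HB.instance Definition _ :=
  PreTopologicalNmodule_isTopologicalNmodule.Build spf_sect spf_add_continuous.
HB.instance Definition _ :=
  TopologicalNmodule_isTopologicalZmodule.Build spf_sect spf_opp_continuous.
HB.instance Definition _ :=
  TopologicalZmodule_isTopologicalRing.Build spf_sect spf_mul_continuous.

End SpfSections.

Section SpfSheaf.
Variable R : admissibleRing.
Implicit Types U V W : opens (spf R).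

Definition spf_res_fun U V (VU : V `<=` U) (s : spf_sect U) : spf_sect V.
Proof.
apply: (@SpfSect _ _ (fun a p Vp => s a p (VU p Vp))) => [a p Vp|a b ab p Vp].
  have [W [Wp [x [d sW]]]] := spf_frac s a (VU p Vp).
  by exists W; split=> //; exists x, d => q Vq; exact: sW.
exact: spf_compat.
Defined.

Let spf_resB U V (VU : V `<=` U) : zmod_morphism (spf_res_fun VU).
Proof. by move=> s t; apply: spf_sectP. Qed.

Let spf_resM U V (VU : V `<=` U) : monoid_morphism (spf_res_fun VU).
Proof. by split=> [|s t]; apply: spf_sectP. Qed.

HB.instance Definition _ U V (VU : V `<=` U) :=
  GRing.isZmodMorphism.Build (spf_sect U) (spf_sect V) (spf_res_fun VU)
    (spf_resB VU).
HB.instance Definition _ U V (VU : V `<=` U) :=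
  GRing.isMonoidMorphism.Build (spf_sect U) (spf_sect V) (spf_res_fun VU)
    (spf_resM VU).

Definition spf_res U V (VU : V `<=` U) : {rmorphism spf_sect U -> spf_sect V} :=
  spf_res_fun VU.

Let spf_irr U (s : spf_sect U) a p (h k : U p) : s a p h = s a p k.
Proof. by rewrite (Prop_irrelevance h k). Qed.

Let spf_res_continuous U V (VU : V `<=` U) : continuous (spf_res VU).
Proof.
move=> s B [a [K [cK KV aB]]]; exists a, K.
split=> //; first exact: (subset_trans KV VU).
by move=> t st; apply: aB => p Vp Kp; exact: st.
Qed.

Let spf_res_id U (UU : U `<=` U) (s : spf_sect U) : spf_res UU s = s.
Proof. by apply: spf_sectP => a p Up; exact: (spf_irr s). Qed.

Let spf_res_comp U V W (VU : V `<=` U) (WV : W `<=` V) (WU : W `<=` U)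
  (s : spf_sect U) : spf_res WV (spf_res VU s) = spf_res WU s.
Proof. by apply: spf_sectP => a p Up; exact: (spf_irr s). Qed.

Let spf_local U (I : Type) (V : I -> opens (spf R)) (VU : forall i, V i `<=` U) :
  U `<=` \bigcup_i V i ->
  forall s t : spf_sect U,
    (forall i, spf_res (VU i) s = spf_res (VU i) t) -> s = t.
Proof.
move=> cov s t st; apply: spf_sectP => a p Up.
have [i _ Vp] := cov p Up.
have E : s a p (VU i p Vp) = t a p (VU i p Vp).
  exact: (congr1 (fun u : spf_sect (V i) => u a p Vp) (st i)).
by rewrite (spf_irr s _ Up (VU i p Vp)) E; exact: (spf_irr t).
Qed.

Let spf_glue U (I : Type) (V : I -> opens (spf R)) (VU : forall i, V i `<=` U) :
  U `<=` \bigcup_i V i ->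
  forall s : (forall i, spf_sect (V i)),
  (forall i j (W : opens (spf R)) (Wi : W `<=` V i) (Wj : W `<=` V j),
     spf_res Wi (s i) = spf_res Wj (s j)) ->
  exists t : spf_sect U, forall i, spf_res (VU i) t = s i.
Proof.
move=> cov s ss.
have ssE i j a p (Vi : V i p) (Vj : V j p) : s i a p Vi = s j a p Vj.
  have W : opensI (V i) (V j) p by split.
  have E : s i a p (opensIl W) = s j a p (opensIr W).
    exact: (congr1 (fun u : spf_sect (opensI (V i) (V j)) => u a p W)
      (ss i j _ (@opensIl _ _ _) (@opensIr _ _ _))).
  by rewrite (spf_irr (s i) _ Vi (opensIl W)) E; exact: (spf_irr (s j)).
have cov' p : U p -> {i | V i p}.
  by move=> Up; apply: cid; have [i] := cov p Up; exists i.
pose t a p Up := s (sval (cov' p Up)) a p (svalP (cov' p Up)).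
have tE i a p Up (Vp : V i p) : t a p Up = s i a p Vp by exact: ssE.
have tfrac (a : idef R) (p : spf R) : U p ->
    exists W : opens (spf R), W p /\
    exists x d : R, forall (q : spf R) (Uq : U q), W q ->
      exists qd : ~ q d, t a q Uq = fraction a x qd.
  move=> Up; have [i _ Vp] := cov p Up.
  have [W [Wp [x [d sW]]]] := spf_frac (s i) a Vp.
  exists (opensI (V i) W); split=> //; exists x, d => q Uq [Vq Wq].
  by have [qd qE] := sW q Vq Wq; exists qd; rewrite (tE i _ _ _ Vq).
have tcompat (a b : idef R) (ab : a `<=` b) p (Up : U p) :
    local_ring_map p ab (t a p Up) = t b p Up by exact: spf_compat.
exists (SpfSect tfrac tcompat) => i.
by apply: spf_sectP => a p Vp /=; exact: tE.
Qed.

Let spf_top U (I : Type) (V : I -> opens (spf R)) (VU : forall i, V i `<=` U) :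
  U `<=` \bigcup_i V i ->
  forall (F : set_system (spf_sect U)) (s : spf_sect U), Filter F ->
  (forall i, spf_res (VU i) @ F --> spf_res (VU i) s) -> F --> s.
Proof.
move=> cov F s FF Fs B [a [K [cK KU aB]]].
have /compact_near_coveringP/(_ _ F
  (fun t p => forall Up : U p, s a p Up = t a p Up)) := cK.
move=> near; apply: filterS (near _ _) => [t st|p Kp].
  by apply: aB => p Up Kp; exact: st.
have [i _ Vp] := cov p (KU p Kp).
have [f [fp fV]] : exists f, basic_open f p /\ basic_open f `<=` V i.
  by apply: basic_open_nbhs; apply: open_nbhs_nbhs; split=> //; exact: opens_open.
have [_ _ aex] := adm_ringP R.
have Ff : F (fun t => spf_agree a (basic_open f) (spf_res (VU i) s)
                        (spf_res (VU i) t)).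
  apply: (Fs i); exists a, (Opens (basic_open_open f)); split=> //.
  exact: basic_open_compact.
exists (basic_open f, fun t => spf_agree a (basic_open f) (spf_res (VU i) s)
                        (spf_res (VU i) t)).
  split=> //=; apply: open_nbhs_nbhs; split=> //; exact: basic_open_open.
move=> [q t] [/= fq st] Uq.
have E : s a q (VU i q (fV q fq)) = t a q (VU i q (fV q fq)).
  exact: (st q (fV q fq) fq).
by rewrite (spf_irr s _ Uq (VU i q (fV q fq))) E; exact: (spf_irr t).
Qed.

Definition Spf : topRingedSpace :=
  @TopRingedSpace (spf R) (fun U => spf_sect U) spf_res spf_res_continuous
    spf_res_id spf_res_comp spf_local spf_glue spf_top.

End SpfSheaf.

(** * Formal schemes *)

(* [f] is an isomorphism of topologically ringed spaces onto an open subspace. *)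
Definition open_immersion (X Y : topRingedSpace) (f : tr_morphism X Y) :=
  [/\ injective f,
      forall U : set X, open U -> open (f @` U) &
      forall V : opens Y, V `<=` range f ->
        bijective (sharp f V) /\
        (forall B : set (sect V), open B -> open (sharp f V @` B))].

Definition formal_scheme (X : topRingedSpace) :=
  forall x : X, exists (R : admissibleRing) (f : tr_morphism (Spf R) X),
    open_immersion f /\ range f x.

Definition locally_noetherian (X : topRingedSpace) :=
  forall x : X, exists (R : admissibleRing) (f : tr_morphism (Spf R) X),
    [/\ noetherian R, adic R, open_immersion f & range f x].

Definition locally_noetherian_formal_scheme (X : topRingedSpace) :=
  formal_scheme X /\ locally_noetherian X.

(** * Closed immersions *)

Section Coherence.
Variable X : topRingedSpace.

(* The subsheaf [P] of O^n restricted to [U] is of finite type. *)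
Definition finite_type_on (U : opens X) n
    (P : forall V : opens X, ('I_n -> sect V) -> Prop) :=
  forall x, U x ->
  exists V : opens X, [/\ V x, V `<=` U &
  exists m (g : 'I_m -> 'I_n -> sect V), (forall j, P V (g j)) /\
    forall (W : opens X) (WV : W `<=` V) (s : 'I_n -> sect W), P W s ->
    forall y, W y ->
    exists (W' : opens X) (W'W : W' `<=` W) (c : 'I_m -> sect W'), W' y /\
      forall i, res W'W (s i) =
        \sum_j c j * res (subset_trans W'W WV) (g j i)].

Definition coherent_ideal (J : forall V : opens X, set (sect V)) :=
  finite_type_on (opensT X) (fun V (s : 'I_1 -> sect V) => J V (s ord0)) /\
  forall (U : opens X) n (s : 'I_n -> sect U), (forall i, J U (s i)) ->
    finite_type_on U (fun V (c : 'I_n -> sect V) =>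
      forall VU : V `<=` U, \sum_i c i * res VU (s i) = 0).

End Coherence.

(* [f] is an isomorphism onto a closed formal subscheme, that is, onto the
   support of O_Y/J with the sheaf of topological rings O_Y/J, for a coherent
   ideal J, which is then the kernel of O_Y -> f_* O_X. The last clause says that
   O_X carries the quotient topology: the sections of O_Y/J over an open set are
   the quotients of those of O_Y only for small (e.g. affine) open sets. *)
Definition closed_immersion (X Y : topRingedSpace) (f : tr_morphism X Y) :=
  [/\ injective f /\ (forall C : set X, closed C -> closed (f @` C)),
      forall (x : X) (b : stalk x), exists a : stalk (f x), stalk_map f x a = b,
      coherent_ideal (fun V => [set s : sect V | sharp f V s = 0]) &
      forall (y : Y) (V : opens Y), V y ->
        exists U : opens Y, [/\ U y, U `<=` V,
          forall t, exists s, sharp f U s = t &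
          forall B : set (sect U), open B -> open (sharp f U @` B)]].

(** * Gluing *)

Section SumTopology.
Variables X Y : topologicalType.

Definition sum_open (W : set (X + Y)) :=
  open (@inl X Y @^-1` W) /\ open (@inr X Y @^-1` W).

Let sum_openT : sum_open setT.
Proof. by split; rewrite preimage_setT; exact: openT. Qed.

Let sum_openI : setI_closed sum_open.
Proof. by move=> A B [? ?] [? ?]; split; rewrite preimage_setI; exact: openI. Qed.

Let sum_openU (I : Type) (f : I -> set (X + Y)) :
  (forall i, sum_open (f i)) -> sum_open (\bigcup_i f i).
Proof.
move=> fo; split; rewrite preimage_bigcup; apply: bigcup_open => i _.
  by case: (fo i).
by case: (fo i).
Qed.

HB.instance Definition _ :=
  isOpenTopological.Build (X + Y)%type sum_openT sum_openI sum_openU.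

End SumTopology.

Section Pushout.
Local Open Scope quotient_scope.
Variables (X Y Z : topRingedSpace).
Variables (alpha : tr_morphism Z X) (beta : tr_morphism Z Y).

Definition glue_rel : X + Y -> X + Y -> Prop :=
  clos_refl_sym_trans (X + Y)%type
    (fun u v => exists z : Z, u = inl (alpha z) /\ v = inr (beta z)).

Definition glue_relb (u v : X + Y) : bool := `[< glue_rel u v >].

Let glue_refl : reflexive glue_relb.
Proof. by move=> u; apply/asboolP/rst_refl. Qed.
Let glue_sym : symmetric glue_relb.
Proof. by move=> u v; apply/asboolP/asboolP => uv; apply: rst_sym. Qed.
Let glue_trans : transitive glue_relb.
Proof.
move=> v u w /asboolP uv /asboolP vw; apply/asboolP.
exact: rst_trans uv vw.
Qed.

Canonical glue_equiv := EquivRel glue_relb glue_refl glue_sym glue_trans.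

Definition pushout_space : topologicalType :=
  quotient_topology {eq_quot glue_equiv}.

Definition pushl (x : X) : pushout_space := \pi_{eq_quot glue_equiv} (inl x).
Definition pushr (y : Y) : pushout_space := \pi_{eq_quot glue_equiv} (inr y).

Lemma push_glue (z : Z) : pushl (alpha z) = pushr (beta z).
Proof. by apply/eqmodP/asboolP; apply: rst_step; exists z. Qed.

Lemma pushl_continuous : continuous pushl.
Proof. by apply/continuousP => W oW; exact: (proj1 oW). Qed.

Lemma pushr_continuous : continuous pushr.
Proof. by apply/continuousP => W oW; exact: (proj2 oW). Qed.

Definition pushz (z : Z) : pushout_space := pushl (alpha z).

Lemma pushz_continuous : continuous pushz.
Proof.
move=> z; apply: (@continuous_comp _ _ _ alpha pushl).
  exact: tr_continuous.
exact: pushl_continuous.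
Qed.

Section Sections.
Variable U : opens pushout_space.

Let Ul := preopen pushl_continuous U.
Let Ur := preopen pushr_continuous U.
Let Uz := preopen pushz_continuous U.

Lemma pushzl : Uz `<=` preopen (@tr_continuous _ _ alpha) Ul.
Proof. by []. Qed.

Lemma pushzr : Uz `<=` preopen (@tr_continuous _ _ beta) Ur.
Proof. by move=> z; rewrite /= /pushz push_glue. Qed.

Definition push_compat (st : sect Ul * sect Ur) : bool :=
  `[< res pushzl (sharp alpha Ul st.1) = res pushzr (sharp beta Ur st.2) >].

Let push_compat_subring : subring_closed push_compat.
Proof.
split=> [|s t|s t]; rewrite !unfold_in.
- by apply/asboolP; rewrite /= !rmorph1.
- move=> /asboolP hs /asboolP ht; apply/asboolP.
  by rewrite /= !rmorphB /= hs ht.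
- move=> /asboolP hs /asboolP ht; apply/asboolP.
  by rewrite /= !rmorphM /= hs ht.
Qed.

HB.instance Definition _ :=
  GRing.isSubringClosed.Build _ push_compat push_compat_subring.

Record push_sect := PushSect {
  push_val :> sect Ul * sect Ur;
  push_valP : push_val \in push_compat }.

HB.instance Definition _ := [isSub for push_val].
HB.instance Definition _ := [Choice of push_sect by <:].
HB.instance Definition _ := 
  GRing.SubChoice_isSubComPzRing.Build _ push_compat push_sect
    push_compat_subring.
HB.instance Definition _ :=
  Topological.copy push_sect (initial_topology push_val).


Lemma push_val_continuous : continuous push_val.
Proof. exact: initial_continuous. Qed.

Let pair_continuous2 (A B : topologicalType) (opA : A -> A -> A)
  (opB : B -> B -> B) :
  continuous (fun z : A * A => opA z.1 z.2) ->
  continuous (fun z : B * B => opB z.1 z.2) ->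
  continuous (fun z : (A * B) * (A * B) =>
    (opA z.1.1 z.2.1, opB z.1.2 z.2.2)).
Proof.
move=> cA cB z; apply: cvg_pair.
  apply: (@continuous_comp _ _ _ (fun z : (A * B) * (A * B) => (z.1.1, z.2.1))
    (fun z => opA z.1 z.2)); last exact: cA.
  apply: cvg_pair.
    by apply: (@continuous_comp _ _ _ fst fst); exact: cvg_fst.
  by apply: (@continuous_comp _ _ _ snd fst); [exact: cvg_snd|exact: cvg_fst].
apply: (@continuous_comp _ _ _ (fun z : (A * B) * (A * B) => (z.1.2, z.2.2))
  (fun z => opB z.1 z.2)); last exact: cB.
apply: cvg_pair.
  by apply: (@continuous_comp _ _ _ fst snd); [exact: cvg_fst|exact: cvg_snd].
by apply: (@continuous_comp _ _ _ snd snd); exact: cvg_snd.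
Qed.

Let push_continuous2 (op : push_sect -> push_sect -> push_sect)
    (opl : sect Ul -> sect Ul -> sect Ul) (opr : sect Ur -> sect Ur -> sect Ur) :
  (forall s t, push_val (op s t) =
     (opl (push_val s).1 (push_val t).1, opr (push_val s).2 (push_val t).2)) ->
  continuous (fun z => opl z.1 z.2) -> continuous (fun z => opr z.1 z.2) ->
  continuous (fun z : push_sect * push_sect => op z.1 z.2).
Proof.
move=> opE cl cr; apply: continuous_comp_initial => z.
rewrite (_ : push_val \o _ = (fun z : (sect Ul * sect Ur) * (sect Ul * sect Ur) =>
    (opl z.1.1 z.2.1, opr z.1.2 z.2.2)) \o
  (fun z : push_sect * push_sect => (push_val z.1, push_val z.2))); last first.
  by apply/funext => -[s t] /=; rewrite opE.
apply: continuous_comp; last exact: pair_continuous2.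
have c1 : continuous (fun z : push_sect * push_sect => push_val z.1).
  move=> w; apply: (@continuous_comp _ _ _ fst push_val); first exact: cvg_fst.
  exact: push_val_continuous.
have c2 : continuous (fun z : push_sect * push_sect => push_val z.2).
  move=> w; apply: (@continuous_comp _ _ _ snd push_val); first exact: cvg_snd.
  exact: push_val_continuous.
exact: (cvg_pair (c1 z) (c2 z)).
Qed.

Let push_add_continuous :
  continuous (fun z : push_sect * push_sect => z.1 + z.2).
Proof. by apply: push_continuous2; first (by []); exact: add_continuous. Qed.

Let push_mul_continuous :
  continuous (fun z : push_sect * push_sect => z.1 * z.2).
Proof. by apply: push_continuous2; first (by []); exact: mulr_continuous. Qed.

Let push_opp_continuous : continuous (fun s : push_sect => - s).
Proof.
apply: continuous_comp_initial => s.
rewrite (_ : push_val \o _ = (fun st => (- st.1, - st.2)) \o push_val) //.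
apply: continuous_comp; first exact: push_val_continuous.
apply: cvg_pair.
  apply: (@continuous_comp _ _ _ fst -%R); first exact: cvg_fst.
  exact: opp_continuous.
apply: (@continuous_comp _ _ _ snd -%R); first exact: cvg_snd.
exact: opp_continuous.
Qed.

HB.instance Definition _ := PreTopologicalNmodule_isTopologicalNmodule.Build
  push_sect push_add_continuous.
HB.instance Definition _ := TopologicalNmodule_isTopologicalZmodule.Build
  push_sect push_opp_continuous.
HB.instance Definition _ := TopologicalZmodule_isTopologicalRing.Build
  push_sect push_mul_continuous.

End Sections.

Implicit Types U V W : opens pushout_space.

Lemma push_sectP U (s t : push_sect U) :
  (push_val s).1 = (push_val t).1 -> (push_val s).2 = (push_val t).2 -> s = t.
Proof. by move=> s1 s2; apply: val_inj; apply: injective_projections. Qed.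

Lemma push_valE U (s : push_sect U) :
  res (@pushzl U) (sharp alpha _ (push_val s).1) =
  res (@pushzr U) (sharp beta _ (push_val s).2).
Proof. by have := push_valP s; rewrite unfold_in => /asboolP. Qed.

Lemma push_res_compat U V (VU : V `<=` U) (s : push_sect U) :
  (res (preopenS pushl_continuous VU) (push_val s).1,
   res (preopenS pushr_continuous VU) (push_val s).2) \in @push_compat V.
Proof.
rewrite unfold_in; apply/asboolP => /=.
have VUz : preopen pushz_continuous V `<=` preopen pushz_continuous U.
  exact: preopenS.
have := congr1 (res VUz) (push_valE s).
have kl := subset_trans VUz (@pushzl U); have kr := subset_trans VUz (@pushzr U).
by rewrite !sharp_res !(res_comp _ _ kl) !(res_comp _ _ kr).
Qed.

Definition push_res_fun U V (VU : V `<=` U) (s : push_sect U) : push_sect V :=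
  PushSect (push_res_compat VU s).

Let push_resB U V (VU : V `<=` U) : zmod_morphism (push_res_fun VU).
Proof. by move=> s t; apply: push_sectP; rewrite /= rmorphB. Qed.

Let push_resM U V (VU : V `<=` U) : monoid_morphism (push_res_fun VU).
Proof.
split=> [|s t]; first by apply: push_sectP; rewrite /= rmorph1.
by apply: push_sectP; rewrite /= rmorphM.
Qed.

HB.instance Definition _ U V (VU : V `<=` U) :=
  GRing.isZmodMorphism.Build (push_sect U) (push_sect V) (push_res_fun VU)
    (push_resB VU).
HB.instance Definition _ U V (VU : V `<=` U) :=
  GRing.isMonoidMorphism.Build (push_sect U) (push_sect V) (push_res_fun VU)
    (push_resM VU).

Definition push_res U V (VU : V `<=` U) :
  {rmorphism push_sect U -> push_sect V} := push_res_fun VU.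

Let push_res_continuous U V (VU : V `<=` U) : continuous (push_res VU).
Proof.
apply: continuous_comp_initial => s.
have c1 : continuous (fun t : push_sect U =>
    res (preopenS pushl_continuous VU) (push_val t).1).
  move=> t; apply: (@continuous_comp _ _ _ (fst \o @push_val U) _).
    apply: continuous_comp; [exact: push_val_continuous|exact: cvg_fst].
  exact: res_continuous.
have c2 : continuous (fun t : push_sect U =>
    res (preopenS pushr_continuous VU) (push_val t).2).
  move=> t; apply: (@continuous_comp _ _ _ (snd \o @push_val U) _).
    apply: continuous_comp; [exact: push_val_continuous|exact: cvg_snd].
  exact: res_continuous.
exact: (cvg_pair (c1 s) (c2 s)).
Qed.

Let push_res_id U (UU : U `<=` U) (s : push_sect U) : push_res UU s = s.
Proof. by apply: push_sectP; exact: res_id. Qed.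

Let push_res_comp U V W (VU : V `<=` U) (WV : W `<=` V) (WU : W `<=` U)
  (s : push_sect U) : push_res WV (push_res VU s) = push_res WU s.
Proof. by apply: push_sectP; exact: res_comp. Qed.

Section Covering.
Variables (U : opens pushout_space) (I : Type) (V : I -> opens pushout_space).
Hypotheses (VU : forall i, V i `<=` U) (cov : U `<=` \bigcup_i V i).

Let covl : preopen pushl_continuous U `<=`
  \bigcup_i preopen pushl_continuous (V i).
Proof. by move=> x /cov[i _ Vx]; exists i. Qed.

Let covr : preopen pushr_continuous U `<=`
  \bigcup_i preopen pushr_continuous (V i).
Proof. by move=> x /cov[i _ Vx]; exists i. Qed.

Let covz : preopen pushz_continuous U `<=`
  \bigcup_i preopen pushz_continuous (V i).
Proof. by move=> x /cov[i _ Vx]; exists i. Qed.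

Lemma push_local (s t : push_sect U) :
  (forall i, push_res (@VU i) s = push_res (@VU i) t) -> s = t.
Proof.
move=> st; apply: push_sectP.
  apply: (@tr_local _ _ _ _ (fun i => preopenS pushl_continuous (@VU i)) covl) => i.
  exact: (congr1 (fun u => (push_val u).1) (st i)).
apply: (@tr_local _ _ _ _ (fun i => preopenS pushr_continuous (@VU i)) covr) => i.
exact: (congr1 (fun u => (push_val u).2) (st i)).
Qed.

Lemma push_glueing (s : forall i, push_sect (V i)) :
  (forall i j W (Wi : W `<=` V i) (Wj : W `<=` V j),
     push_res Wi (s i) = push_res Wj (s j)) ->
  exists t : push_sect U, forall i, push_res (@VU i) t = s i.
Proof.
move=> ss.
have [|tl tlE] := @tr_glue X _ _ _
    (fun i => preopenS pushl_continuous (@VU i)) covl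
    (fun i => (push_val (s i)).1).
  move=> i j W Wi Wj.
  have := congr1 (fun u => (push_val u).1)
    (ss i j (opensI (V i) (V j)) (@opensIl _ _ _) (@opensIr _ _ _)).
  have WI : W `<=` preopen pushl_continuous (opensI (V i) (V j)).
    by move=> x Wx; split; [exact: Wi|exact: Wj].
  by move=> /(congr1 (res WI)) /=; rewrite !(res_comp _ _ Wi) !(res_comp _ _ Wj).
have [|tr trE] := @tr_glue Y _ _ _
    (fun i => preopenS pushr_continuous (@VU i)) covr
    (fun i => (push_val (s i)).2).
  move=> i j W Wi Wj.
  have := congr1 (fun u => (push_val u).2)
    (ss i j (opensI (V i) (V j)) (@opensIl _ _ _) (@opensIr _ _ _)).
  have WI : W `<=` preopen pushr_continuous (opensI (V i) (V j)).
    by move=> x Wx; split; [exact: Wi|exact: Wj].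
  by move=> /(congr1 (res WI)) /=; rewrite !(res_comp _ _ Wi) !(res_comp _ _ Wj).
have tc : (tl, tr) \in @push_compat U.
  rewrite unfold_in; apply/asboolP => /=.
  apply: (@tr_local _ _ _ _ (fun i => preopenS pushz_continuous (@VU i)) covz).
  move=> i; have := push_valE (s i); rewrite -tlE -trE.
  have kl := subset_trans (preopenS pushz_continuous (@VU i)) (@pushzl U).
  have kr := subset_trans (preopenS pushz_continuous (@VU i)) (@pushzr U).
  by rewrite !sharp_res !(res_comp _ _ kl) !(res_comp _ _ kr).
by exists (PushSect tc) => i; apply: push_sectP => /=; [exact: tlE|exact: trE].
Qed.

Lemma push_top (F : set_system (push_sect U)) (s : push_sect U) : Filter F ->
  (forall i, push_res (@VU i) @ F --> push_res (@VU i) s) -> F --> s.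
Proof.
move=> FF Fs.
have cl : (fst \o @push_val U) @ F --> (push_val s).1.
  apply: (@tr_top _ _ _ _ (fun i => preopenS pushl_continuous (@VU i)) covl).
  move=> i; have vc := @push_val_continuous (V i) (push_res (@VU i) s).
  move=> A nA.
  suff: F (push_res (@VU i) @^-1` (@push_val (V i) @^-1` (fst @^-1` A))) by [].
  apply: (Fs i); apply: vc.
  have cfst : continuous (@fst (sect (preopen pushl_continuous (V i)))
      (sect (preopen pushr_continuous (V i)))).
    by move=> z; exact: cvg_fst.
  exact: (cfst (push_val (push_res (@VU i) s)) A nA).
have cr : (snd \o @push_val U) @ F --> (push_val s).2.
  apply: (@tr_top _ _ _ _ (fun i => preopenS pushr_continuous (@VU i)) covr).
  move=> i; have vc := @push_val_continuous (V i) (push_res (@VU i) s).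
  move=> A nA.
  suff: F (push_res (@VU i) @^-1` (@push_val (V i) @^-1` (snd @^-1` A))) by [].
  apply: (Fs i); apply: vc.
  have csnd : continuous (@snd (sect (preopen pushl_continuous (V i)))
      (sect (preopen pushr_continuous (V i)))).
    by move=> z; exact: cvg_snd.
  exact: (csnd (push_val (push_res (@VU i) s)) A nA).
have cp : @push_val U @ F --> push_val s.
  move=> A; rewrite [push_val s]surjective_pairing => /(cvg_pair cl cr).
  suff: F [set t | A ((push_val t).1, (push_val t).2)] -> F (@push_val U @^-1` A).
    by [].
  by apply: filterS => t /=; rewrite -surjective_pairing.
move=> A [_ [[B oB <-] Bs BA]].
apply: filterS BA _; apply: (cp B); exact: open_nbhs_nbhs.
Qed.

End Covering.

Definition pushout : topRingedSpace :=
  @TopRingedSpace pushout_space (fun U => push_sect U) push_res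
    push_res_continuous push_res_id push_res_comp push_local push_glueing
    push_top.

End Pushout.

(** * Singular points *)

Definition regular_at (W : topRingedSpace) (w : W) :=
  regular_local_ring (stalk w).

Definition singular_at (W : topRingedSpace) (w : W) := ~ regular_at w.

(* Main.v *)
(* A regular local ring is a domain, whereas for z in Z the stalk of the pushout
   at the image of z has zero divisors: the surjection from the stalk of X at
   alpha z to the stalk of Z at z has a nonzero kernel, and so has its analogue
   for Y. Representatives s and t of nonzero elements of the two kernels extend
   by zero to sections (s, 0) and (0, t) of the pushout, since its points over Z
   have small neighbourhoods, alpha and beta being closed embeddings. *)
Require Import Defs.
From mathcomp Require Import all_boot all_algebra all_classical.
From mathcomp Require Import topology ring.
Local Open Scope classical_set_scope.

Import GRing.Theory.
Local Open Scope ring_scope.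

(** Otherwise a choice of strictly larger members, iterated from [I0], gives a strictly increasing
    chain; its union is an ideal whose finitely many generators all lie in one term. *)
Lemma noetherian_max {R : comPzRingType} (F : set (set R)) (I0 : set R) :
  noetherian R -> (forall I, F I -> is_ideal I) -> F I0 ->
  exists2 I, F I & forall J, F J -> I `<=` J -> J `<=` I.
Proof.
move=> nR Fid FI0; apply: contrapT => nomax.
have /choice[f fP] : forall I : {I | F I}, exists J : {J | F J},
    sval I `<=` sval J /\ ~ (sval J `<=` sval I).
  move=> [I FI]; apply: contrapT => h; apply: nomax; exists I => // J FJ IJ.
  by apply: contrapT => JI; apply: h; exists (exist _ J FJ).
pose c n : set R := sval (iter n f (exist _ I0 FI0)).
have cid n : is_ideal (c n) by apply: Fid; rewrite /c; case: (iter n f _).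
have cmono m n : (m <= n)%N -> c m `<=` c n.
  elim: n => [|n IHn]; first by rewrite leqn0 => /eqP ->.
  rewrite leq_eqVlt => /orP[/eqP -> //|/IHn mn].
  exact: subset_trans mn (fP _).1.
have [n [g E]] : exists n (g : 'I_n -> R), \bigcup_n c n =
    [set x | exists a : 'I_n -> R, x = \sum_i a i * g i].
  apply: nR; split.
  - by exists 0%N => //; case: (cid 0%N).
  - move=> x y [i _ xi] [j _ yj]; exists (maxn i j) => //.
    case: (cid (maxn i j)) => _ + _; apply.
      by apply: cmono xi; rewrite leq_maxl.
    by apply: cmono yj; rewrite leq_maxr.
  - by move=> r x [i _ xi]; exists i => //; case: (cid i) => _ _; apply.
have /choice[k kP] : forall i, exists k, c k (g i).
  move=> i; have [] : (\bigcup_n c n) (g i); last by move=> k _; exists k.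
  rewrite E; exists (fun j => (j == i)%:R).
  rewrite (bigD1 i) //= eqxx mul1r big1 ?addr0 // => j /negbTE ->.
  by rewrite mul0r.
pose N := (\max_i k i)%N.
have gN i : c N (g i) by apply: cmono (kP i); exact: leq_bigmax.
have [_] := fP (iter N f (exist _ I0 FI0)); apply => x xN.
have : (\bigcup_n c n) x by exists N.+1.
rewrite E => -[a ->]; case: (cid N) => c0 cD cM.
by apply: (big_ind (c N)) => // i _; apply: cM; exact: gN.
Qed.

(** * Ideal operations, Nakayama's lemma and Krull's principal ideal theorem *)

Section Operations.
Set Implicit Arguments.
Unset Strict Implicit.
Context {R : comPzRingType}.
Implicit Types (p I E : set R) (x : R).

Lemma idealN I x : is_ideal I -> I x -> I (- x).
Proof. by move=> [_ _ IM] /(IM (-1)); rewrite mulN1r. Qed.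

Lemma idealB I x y : is_ideal I -> I x -> I y -> I (x - y).
Proof. by move=> idI Ix Iy; case: (idI) => _ ID _; apply: ID => //; exact: idealN. Qed.

(* The preimage in R of the extension of I to the localization of R at p. *)
Definition saturation p I : set R := [set a | exists2 s, ~ p s & I (s * a)].

(** For an ideal [I], this is [I + (x)]. *)
Definition adjoin I x : set R := [set a | exists r, I (a - r * x)].

(** An intersection rather than finite sums: to place the span inside an ideal, it is enough to
    apply its membership proof. *)
Definition span E : set R := [set a | forall I, is_ideal I -> E `<=` I -> I a].

Lemma prime_not1 p : is_prime p -> ~ p 1. Proof. by case. Qed.

Lemma prime_notM p x y : is_prime p -> ~ p x -> ~ p y -> ~ p (x * y).
Proof. by move=> [_ _ pP] px py /pP[]. Qed.

Lemma saturation_ideal p I : is_prime p -> is_ideal I -> is_ideal (saturation p I).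
Proof.
move=> pp [I0 ID IM]; split.
- by exists 1; rewrite ?mulr0 //; exact: prime_not1.
- move=> x y [s ps Ix] [t pt Iy]; exists (s * t); first exact: prime_notM.
  rewrite (_ : s * t * (x + y) = t * (s * x) + s * (t * y)); last by ring.
  by apply: ID; apply: IM.
- move=> r x [s ps Ix]; exists s => //.
  by rewrite mulrCA; exact: IM.
Qed.

Lemma sub_saturation p I : is_prime p -> I `<=` saturation p I.
Proof. by move=> pp x Ix; exists 1; rewrite ?mul1r //; exact: prime_not1. Qed.

Lemma saturation_id p I : is_prime p ->
  saturation p (saturation p I) `<=` saturation p I.
Proof.
move=> pp x [s ps [t pt Ix]]; exists (t * s); first exact: prime_notM.
by rewrite -mulrA.
Qed.

Lemma saturationS p I J : I `<=` J -> saturation p I `<=` saturation p J.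
Proof. by move=> IJ x [s ps /IJ]; exists s. Qed.

Lemma saturation_prime p q : is_prime q -> q `<=` p -> saturation p q `<=` q.
Proof. by move=> [_ _ qP] qp x [s ps /qP[/qp|]]. Qed.

Lemma adjoin_ideal I x : is_ideal I -> is_ideal (adjoin I x).
Proof.
move=> [I0 ID IM]; split.
- by exists 0; rewrite mul0r subr0.
- move=> a b [r Ir] [s Is]; exists (r + s).
  rewrite (_ : a + b - (r + s) * x = (a - r * x) + (b - s * x)); last by ring.
  exact: ID.
- move=> c a [r Ir]; exists (c * r).
  by rewrite -mulrA -mulrBr; exact: IM.
Qed.

Lemma sub_adjoin I x : I `<=` adjoin I x.
Proof. by move=> a Ia; exists 0; rewrite mul0r subr0. Qed.

Lemma mem_adjoin I x : is_ideal I -> adjoin I x x.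
Proof. by move=> [I0 _ _]; exists 1; rewrite mul1r subrr. Qed.

Lemma adjoinS I J x : I `<=` J -> adjoin I x `<=` adjoin J x.
Proof. by move=> IJ a [r /IJ]; exists r. Qed.

Lemma adjoin_sub I J x : is_ideal J -> I `<=` J -> J x -> adjoin I x `<=` J.
Proof.
move=> [_ JD JM] IJ Jx a [r /IJ Ja].
by rewrite -(subrK (r * x) a); apply: JD => //; exact: JM.
Qed.

Lemma span_ideal E : is_ideal (span E).
Proof.
split.
- by move=> I [].
- by move=> x y Ex Ey I idI EI; case: (idI) => _ ID _; apply: ID;
    [exact: Ex|exact: Ey].
- by move=> r x Ex I idI EI; case: (idI) => _ _ IM; apply: IM; exact: Ex.
Qed.

Lemma sub_span E : E `<=` span E.
Proof. by move=> x Ex I _; apply. Qed.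

Lemma spanS E F : E `<=` F -> span E `<=` span F.
Proof. by move=> EF x Ex I idI FI; apply: Ex => // y /EF /FI. Qed.

(* Localized Nakayama: I_p = N_p + p I_p implies I_p = N_p. A saturated ideal
   maximal among those that contain N but not I must contain p I. *)
Lemma nakayama p I N : noetherian R -> is_prime p -> is_ideal I -> is_ideal N ->
  I `<=` saturation p (span (N `|` [set r * b | r in p & b in I])) ->
  I `<=` saturation p N.
Proof.
move=> nR pp idI idN INI; apply: contrapT => nIN.
pose F K := [/\ is_ideal K, N `<=` K, saturation p K `<=` K & ~ (I `<=` K)].
have [||K [idK NK sK nIK] Kmax] := @noetherian_max R F (saturation p N) nR.
- by move=> K [].
- split=> //; [exact: saturation_ideal|exact: sub_saturation|exact: saturation_id].
apply: nIK => a /INI; suff sub : span (N `|` [set r * b | r in p & b in I]) `<=` K.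
  by move/(saturationS sub)/sK.
move=> y; apply => // _ [/NK //|[r pr [b Ib <-]]]; apply: contrapT => nK.
pose K' := saturation p (adjoin K (r * b)).
have idK' : is_ideal K' by apply: saturation_ideal => //; exact: adjoin_ideal.
have KK' : K `<=` K'.
  by apply: subset_trans (sub_saturation pp); exact: sub_adjoin.
(* If [K'] did not contain [I], it would belong to [F], and the maximality of [K] would put [r * b]
   in [K]. *)
have [s ps [t]] : K' b.
  suff : I `<=` K' by apply.
  apply: contrapT => nIK'; apply: nK.
  have /Kmax/(_ KK') : F K'.
    split=> //; [exact: subset_trans KK'|exact: saturation_id].
  by apply; apply: sub_saturation => //; exact: mem_adjoin.
(* Since [r] lies in [p] and [s] does not, [s - t * r] is outside [p] and can be cancelled in the
   saturated ideal [K]. *)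
rewrite mulrA -mulrBl => Kb; apply: nK.
case: (idK) => _ _ KM; apply: KM; apply: sK; exists (s - t * r) => // pst.
apply: ps; rewrite -(subrK (t * r) s); case: (pp) => -[_ pD pM] _ _.
by apply: pD => //; exact: pM.
Qed.

(* R_q/B_q is Artinian when q is a minimal prime over B. *)
Lemma saturation_dcc q B (K : nat -> set R) : noetherian R -> is_prime q ->
  is_ideal B -> saturation q B `<=` B ->
  (forall p, is_prime p -> B `<=` p -> p `<=` q -> q `<=` p) ->
  (forall n, [/\ is_ideal (K n), saturation q (K n) `<=` K n & B `<=` K n]) ->
  (forall n, K n.+1 `<=` K n) ->
  exists n, K n `<=` K n.+1.
Proof.
move=> nR pq idB sB qmin KP Kdec.
(* The goal is that the unit ideal is stable. A proper maximal [I] in [F] could still be enlarged by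
   an [a] outside [I] with [q a] inside [I]. *)
pose stable I := exists N, forall n, (N <= n)%N -> K n `&` I `<=` K n.+1.
pose F I := [/\ is_ideal I, B `<=` I, saturation q I `<=` I & stable I].
have [||I [idI BI sI [N IN]] Imax] := @noetherian_max R F B nR.
- by move=> I [].
- split=> //; exists 0%N => n _ x [_ Bx]; have [_ _] := KP n.+1; exact.
have [I0 ID IM] := idI.
have [I1|nI1] := pselect (I 1).
  exists N => x Kx; apply: (IN N) => //; split=> //.
  by rewrite -(mulr1 x); exact: IM.
(* A maximal colon ideal [(I : a)] with [a] outside [I] is prime. It contains [B], and lies in [q]
   because [I] is saturated, so by minimality it contains [q]. *)
pose G C := exists2 a, ~ I a & C = [set r | I (r * a)].
have Gid C : G C -> is_ideal C.
  move=> [a _ ->]; split=> [|x y /= Ix Iy|r x /= Ix].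
  - by rewrite /= mul0r.
  - by rewrite mulrDl; exact: ID.
  - by rewrite -mulrA; exact: IM.
have [|C GC Cmax] := @noetherian_max R G [set r | I (r * 1)] nR Gid.
  by exists 1.
have [a nIa CE] := GC.
have qa r : q r -> I (r * a).
  suff : q `<=` C by rewrite CE; apply.
  apply: qmin.
  - split; [exact: Gid| by rewrite CE /= mul1r|].
    move=> x y Cxy; have [Cy|nCy] := pselect (C y); [by right|left].
    apply: (Cmax [set z | I (z * (y * a))]).
    + by exists (y * a) => // Iy; apply: nCy; rewrite CE.
    + by move=> z; rewrite CE /= mulrCA; exact: IM.
    + by move: Cxy; rewrite CE /= mulrA.
  - by move=> x /BI Ix; rewrite CE /= mulrC; exact: IM.
  - move=> b; rewrite CE /= => Iba; apply: contrapT => qb.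
    by apply: nIa; apply: sI; exists b.
pose I' := saturation q (adjoin I a).
suff FI' : F I'.
  case: nIa; apply: (Imax I') => //.
    by apply: subset_trans (sub_saturation pq); exact: sub_adjoin.
  by apply: sub_saturation => //; exact: mem_adjoin.
split.
- by apply: saturation_ideal => //; exact: adjoin_ideal.
- apply: subset_trans BI _; apply: subset_trans (sub_saturation pq).
  exact: sub_adjoin.
- exact: saturation_id.
(* Locally at [q], [I' / I] is a copy of the residue field. So if every [K M] meets [I'] outside
   [I], an element [b] of [K n.+1] there generates [I'] modulo [I] up to denominators, and stability
   of [I] handles the remainder. *)
have [[M KI]|nKI] := pselect (exists M, K M `&` I' `<=` I).
  have KM n : (M <= n)%N -> K n `<=` K M.
    elim: n => [|n IHn]; first by rewrite leqn0 => /eqP ->.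
    rewrite leq_eqVlt => /orP[/eqP <- //|/IHn]; exact: subset_trans.
  exists (maxn M N) => n; rewrite geq_max => /andP[Mn Nn] x [Kx I'x].
  by apply: (IN n) => //; split=> //; apply: KI; split=> //; exact: KM Kx.
exists N => n Nn y [Ky [t qt [r' Iy]]].
have [b [[Kb [s qs [r Ib]]] nIb]] : exists b, (K n.+1 `&` I') b /\ ~ I b.
  apply: contrapT => h; apply: nKI; exists n.+1 => b Kb.
  by apply: contrapT => nIb; apply: h; exists b.
have [_ sK _] := KP n.+1; have [[_ KD' KM'] _ _] := KP n.
have qr : ~ q r.
  move=> /qa Ira; apply: nIb; apply: sI; exists s => //.
  by rewrite -(subrK (r * a) (s * b)); exact: ID.
apply: sK; exists (r * t); first exact: prime_notM.
have [[_ KD KM] _ _] := KP n.+1.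
rewrite -(subrK (r' * (s * b)) (r * t * y)); apply: KD; last by do 2!apply: (KM).
apply: (IN n) => //; split.
  apply: idealB; [by case: (KP n)|exact: KM'|do 2!apply: (KM'); exact: Kdec].
rewrite (_ : _ - _ = r * (t * y - r' * a) - r' * (s * b - r * a)); last by ring.
by apply: idealB => //; exact: IM.
Qed.

(* The symbolic powers of q modulo p. *)
Fixpoint symbolic_power p q n : set R :=
  if n is n'.+1 then
    saturation q (span (p `|` [set u * v | u in q & v in symbolic_power p q n']))
  else setT.

Lemma symbolic_power_ideal p q n : is_prime q -> is_ideal (symbolic_power p q n).
Proof.
by move=> pq; case: n => [//|n]; apply: saturation_ideal => //; exact: span_ideal.
Qed.

Lemma symbolic_power_saturated p q n : is_prime q ->
  saturation q (symbolic_power p q n) `<=` symbolic_power p q n.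
Proof. by move=> pq; case: n => [//|n]; exact: saturation_id. Qed.

Lemma sub_symbolic_power p q n : is_prime q -> p `<=` symbolic_power p q n.
Proof.
move=> pq; case: n => [//|n] x px; apply: sub_saturation => //.
by apply: sub_span; left.
Qed.

Lemma symbolic_powerS p q n :
  symbolic_power p q n.+1 `<=` symbolic_power p q n.
Proof.
elim: n => [//|n IHn]; apply: saturationS; apply: spanS => x [px|]; first by left.
by move=> [u qu [v /IHn vn <-]]; right; exists u => //; exists v.
Qed.

Lemma symbolic_powerX p q n x : is_prime q -> q x ->
  symbolic_power p q n (x ^+ n).
Proof.
move=> pq qx; elim: n => [//|n IHn]; apply: sub_saturation => //.
by apply: sub_span; right; exists x => //; exists (x ^+ n) => //; rewrite -exprS.
Qed.

Lemma primeX p x n : is_prime p -> p (x ^+ n) -> p x.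
Proof.
by move=> [_ p1 pP]; elim: n => [/p1 //|n IHn]; rewrite exprS => /pP[|/IHn].
Qed.

(* Krull's principal ideal theorem: otherwise q2 is minimal over q0 + (x), and
   the symbolic powers of q1 are eventually constant. *)
Lemma prime_between q0 q1 q2 x : noetherian R ->
  is_prime q0 -> is_prime q1 -> is_prime q2 -> q0 `<` q1 -> q1 `<` q2 -> q2 x ->
  exists q, [/\ is_prime q, q0 `<` q, q `<` q2 & q x].
Proof.
move=> nR p0 p1 p2 q01 q12 q2x.
have [q1x|q1x] := pselect (q1 x); first by exists q1.
apply: contrapT => none.
have q0x : ~ q0 x by move/q01.1.
have qmin p : is_prime p -> q0 `<=` p -> p x -> p `<=` q2 -> q2 `<=` p.
  move=> pp q0p px pq2; apply: contrapT => q2p; apply: none; exists p; split=> //.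
  by split=> // /(_ _ px).
pose J n := symbolic_power q0 q1 n.
have idJ n : is_ideal (J n) by exact: symbolic_power_ideal.
have sJ n : saturation q1 (J n) `<=` J n by exact: symbolic_power_saturated.
have JS n : J n.+1 `<=` J n by exact: symbolic_powerS.
have [id0 _ _] := p0.
have [|||||n Kn] := @saturation_dcc q2 (saturation q2 (adjoin q0 x))
    (fun n => saturation q2 (adjoin (J n) x)) nR p2.
- by apply: saturation_ideal => //; exact: adjoin_ideal.
- exact: saturation_id.
- move=> p pp sub pq2.
  have {}sub := subset_trans (sub_saturation p2) sub.
  apply: qmin => //; last by apply: sub; exact: mem_adjoin.
  by apply: subset_trans sub; exact: sub_adjoin.
- move=> n; split; [|exact: saturation_id|].
    by apply: saturation_ideal => //; exact: adjoin_ideal.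
  by apply: saturationS; apply: adjoinS; exact: sub_symbolic_power.
- by move=> n; apply: saturationS; exact: adjoinS.
(* If [s * a - r * x] lies in [J n.+1] with [a] in [J n], then [r * x] is in [J n], hence [r] is too
   because [x] is outside [q1]. So Nakayama applies at [q2]. *)
have JS' : J n `<=` J n.+1.
  suff : J n `<=` saturation q2 (J n.+1).
    move=> sub; apply: (subset_trans sub) => a [s q2s Ja].
    by apply: sJ; exists s => // /q12.1.
  apply: nakayama => // a Ja.
  have [|s q2s [r Jr]] := Kn a.
    by apply: sub_saturation => //; exact: sub_adjoin.
  exists s => //; rewrite -(subrK (r * x) (s * a)).
  case: (span_ideal (J n.+1 `|` [set u * v | u in q2 & v in J n])) => _ + _.
  apply; first by apply: sub_span; left.
  apply: sub_span; right; exists x => //; exists r; last by rewrite mulrC.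
  apply: sJ; exists x => //.
  rewrite (_ : x * r = s * a - (s * a - r * x)); last by ring.
  by apply: idealB => //; [case: (idJ n) => _ _; apply|exact: JS].
(* By the definition of [J n.+1], the inclusion [JS'] is the hypothesis of Nakayama at [q1] with
   [N = q0]. *)
have J0 : J n `<=` q0.
  apply: (subset_trans (nakayama nR p1 (idJ n) id0 JS')).
  by apply: saturation_prime => //; case: q01.
case: q01 => _; apply => a q1a; apply: (@primeX _ _ n p0); apply: J0.
exact: symbolic_powerX.
Qed.

(** * Chains of primes and regular local rings *)

Definition is_chain n (p : nat -> set R) :=
  (forall i, (i <= n)%N -> is_prime (p i)) /\
  (forall i, (i < n)%N -> p i `<` p i.+1).

Lemma is_chain_sub n (p : nat -> set R) : is_chain n p -> p 0%N `<=` p n.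
Proof.
move=> [_ pS]; elim: n pS => [_ //|n IHn pS]; apply: (@subset_trans _ (p n)).
  by apply: IHn => i ni; apply: pS; exact: ltnW.
by have [] := pS n (leqnn _).
Qed.

(** The element [x] is pushed down from the top: [prime_between] replaces the prime just below the
    top by one containing [x], and induction applies to the chain without its top. *)
Lemma is_chain_through n (p : nat -> set R) x :
  noetherian R -> is_chain n.+1 p -> p n.+1 x ->
  exists p' : nat -> set R,
    [/\ is_chain n.+1 p', p' 0%N = p 0%N, p' n.+1 = p n.+1 & p' 1%N x].
Proof.
move=> nR; elim: n p => [|n IHn] p [pp pS] px; first by exists p.
have [||||||q [pq nq qn qx]] := @prime_between (p n) (p n.+1) (p n.+2) x nR.
- by apply: pp; do 2!apply: leqW.
- exact: pp.
- exact: pp.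
- exact: pS.
- exact: pS.
- by [].
pose p1 i := if i == n.+1 then q else p i.
have p1n : p1 n.+1 = q by rewrite /p1 eqxx.
have [||p' [[p'p p'S] p'0 p'n p'x]] := IHn p1.
- split=> i ni; rewrite /p1; first by case: eqP => // _; apply: pp; exact: leqW.
  rewrite (ltn_eqF ni); case: eqP => [[->] //|_]; apply: pS; exact: ltnW.
- by rewrite p1n.
exists (fun i => if i == n.+2 then p n.+2 else p' i); split; rewrite ?eqxx //.
split=> i ni.
  case: eqP => [_|/eqP ne]; first exact: pp.
  by apply: p'p; rewrite -ltnS ltn_neqAle ne.
rewrite (ltn_eqF ni); case: eqP => [[->]|/eqP ne]; first by rewrite p'n p1n.
by apply: p'S; rewrite -ltnS ltn_neqAle ne.
Qed.

(* This is "R/I regular of dimension n implies R/I is a domain", for R local.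
   If y i is not in p 0, the chain can be moved so that p 1 contains y i; by
   induction p 1 = I + (y i), whence p 0 = I + y i * p 0. *)
Lemma chain_bottom n m I (y : 'I_n -> R) (p : nat -> set R) : noetherian R ->
  is_prime m -> (forall N, is_ideal N -> saturation m N `<=` N) ->
  is_ideal I -> (forall i, m (y i)) ->
  (forall a, m a -> exists c : 'I_n -> R, I (a - \sum_i c i * y i)) ->
  is_chain n p -> p n = m -> I `<=` p 0%N -> p 0%N `<=` I.
Proof.
move=> nR pm sm; elim: n I y p => [|n IHn] I y p idI my mI pc pn Ip.
  by rewrite pn => a /mI[c]; rewrite big_ord0 subr0.
have pr0 : is_prime (p 0%N) by case: pc => + _; apply.
have [[p00 p0D p0M] _ p0P] := pr0.
(* If every [y i] lay in [p 0], so would [m], the top of the chain, against strictness. *)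
have [i p0i] : exists i, ~ p 0%N (y i).
  apply: contrapT => h.
  have p0y i : p 0%N (y i) by apply: contrapT => hi; apply: h; exists i.
  have : p n.+1 `<=` p n.
    rewrite pn => a /mI[c /Ip].
    have pcn : is_chain n p.
      by case: pc => pp pS; split=> i ni; [apply: pp|apply: pS]; exact: leqW.
    move=> p0a; apply: (is_chain_sub pcn).
    rewrite -(subrK (\sum_i c i * y i) a); apply: (p0D) => //.
    by apply: (big_ind (p 0%N)) => // i _; exact: p0M.
  by case: pc => _ /(_ n (leqnn _)) [].
have [|p' [[p'p p'S] p'0 p'n p'1]] := @is_chain_through n p (y i) nR pc.
  by rewrite pn.
have idp'1 : is_ideal (p' 1%N) by have [] := p'p 1%N.
have p1I : p' 1%N `<=` adjoin I (y i).
  apply: (IHn _ (fun j => y (lift i j)) (fun j => p' j.+1)) => //.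
  - exact: adjoin_ideal.
  - move=> a /mI[c cI]; exists (fun j => c (lift i j)); exists (c i).
    by move: cI; rewrite (bigD1_ord i) //= opprD addrA addrAC.
  - by split=> j jn; [exact: p'p|exact: p'S].
  - by rewrite p'n.
  - apply: adjoin_sub => //; apply: subset_trans Ip _.
    by rewrite -p'0; case: (p'S 0%N).
apply: (subset_trans _ (sm I idI)); apply: nakayama => // a p0a.
apply: sub_saturation => //.
have [|r Ir] := p1I a; first by case: (p'S 0%N) => // + _; rewrite p'0; apply.
rewrite -(subrK (r * y i) a).
case: (span_ideal (I `|` [set r * b | r in m & b in p 0%N])) => _ + _.
apply; apply: sub_span; first by left.
right; exists (y i) => //; exists r; last by rewrite mulrC.
have : p 0%N (r * y i).
  rewrite (_ : r * y i = a - (a - r * y i)); last by ring.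
  by apply: idealB => //; exact: Ip.
by move/p0P => [].
Qed.

Lemma maximal_prime (m : set R) : is_maximal m -> is_prime m.
Proof.
move=> [idm m1 mmax]; split=> // x y mxy.
have [mx|nmx] := pselect (m x); [by left|right].
have [[r]|n1] := pselect (adjoin m x 1).
  move=> h; have [_ mD mM] := idm.
  rewrite (_ : y = y * (1 - r * x) + r * (x * y)); last by ring.
  by apply: mD; exact: mM.
case: nmx; rewrite -(mmax _ (adjoin_ideal _ idm) n1); first exact: mem_adjoin.
exact: sub_adjoin.
Qed.

(** [noetherian_max] takes the place of Zorn's lemma: [I] lies in some maximal ideal, and [m] is the
    only one. *)
Lemma sub_maximal (m : set R) I : noetherian R -> local_ring_at m ->
  is_ideal I -> ~ I 1 -> I `<=` m.
Proof.
move=> nR [_ mu] idI I1.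
pose F K := [/\ is_ideal K, I `<=` K & ~ K 1].
have [||K [idK IK K1] Kmax] := @noetherian_max R F I nR.
- by move=> K [].
- by split.
rewrite -(mu K) //; split=> // J idJ J1 KJ; apply/seteqP; split=> //.
by apply: Kmax => //; split=> //; exact: subset_trans KJ.
Qed.

(** By Nakayama a lifted basis of the cotangent space generates [m]. It has as many elements as a
    longest chain of primes has steps, so [chain_bottom] with [I = 0] shows that the bottom prime is
    zero. *)
Lemma regular_local_ring_prime0 : regular_local_ring R -> is_prime [set 0 : R].
Proof.
move=> [nR [m [d [lm [x [mx gen _]] [[p pc] _]]]]].
have pm := maximal_prime lm.1; have [idm m1 _] := pm.
have id0 : is_ideal [set 0 : R].
  by split=> // [a b -> ->|r a ->]; rewrite /= ?addr0 ?mulr0.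
(* An element [s] outside [m] is a unit: otherwise the proper ideal [(s)] would lie in [m]. *)
have sm N : is_ideal N -> saturation m N `<=` N.
  move=> idN a [s ms Na]; have [[r]|n1] := pselect (adjoin [set 0] s 1).
    move=> /subr0_eq h; rewrite -(mul1r a) h -mulrA.
    by case: idN => _ _; apply.
  case: ms; apply: (@sub_maximal m (adjoin [set 0] s)) => //.
    exact: adjoin_ideal.
  exact: mem_adjoin.
pose X := [set a | exists c : 'I_d -> R, a = \sum_i c i * x i].
have idX : is_ideal X.
  split.
  - by exists (fun=> 0); rewrite big1 // => i _; rewrite mul0r.
  - move=> _ _ [c ->] [c' ->]; exists (fun i => c i + c' i).
    by rewrite -big_split; apply: eq_bigr => i _; rewrite mulrDl.
  - move=> r _ [c ->]; exists (fun i => r * c i).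
    by rewrite mulr_sumr; apply: eq_bigr => i _; rewrite mulrA.
have mX : m `<=` X.
  apply: (subset_trans _ (sm X idX)); apply: nakayama => // a ma.
  apply: sub_saturation => //; have [c [n [u [v [mu mv E]]]]] := gen a ma.
  rewrite -(subrK (\sum_i c i * x i) a).
  have [s0 sD sM] := span_ideal (X `|` [set r * b | r in m & b in m]).
  apply: (sD); last by apply: sub_span; left; exists c.
  rewrite E; apply: (big_ind (span (X `|` [set r * b | r in m & b in m]))) => // i _.
  apply: sub_span; right; exists (u i) => //; exists (v i) => //.
  have [k [w [t [mw _ ->]]]] := mv i; case: (idm) => m0 mD mM.
  by apply: (big_ind m) => // j _; rewrite mulrC; exact: mM.
(* Putting [m] on top spares a proof that [p d] equals [m]; the inclusions stay strict since [p d]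
   lies in [m]. *)
pose q i := if i == d then m else p i.
have qc : is_chain d q.
  case: pc => pp pS; split=> i di; rewrite /q; first by case: eqP => // _; exact: pp.
  rewrite (ltn_eqF di); case: eqP => [E|_]; last exact: pS.
  have [pi1 np] := pS i di; have [idp p1 _] := pp _ di.
  have pm' : p i.+1 `<=` m by apply: sub_maximal.
  by split; [exact: subset_trans pm'|move=> mp; apply: np; exact: subset_trans mp].
have : q 0%N `<=` [set 0].
  apply: (@chain_bottom d m _ x) => //.
  - by move=> a /mX[c ->]; exists c; rewrite subrr.
  - by rewrite /q eqxx.
  - by move=> _ ->; case: qc => /(_ 0%N isT) [[]].
have q0 : is_prime (q 0%N) by case: qc => + _; apply.
move=> sub; rewrite (_ : [set 0] = q 0%N) //; apply/seteqP; split=> // _ ->.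
by case: q0 => -[].
Qed.

End Operations.

(** * Kernels on stalks of closed immersions *)

Section Gluing.
Set Implicit Arguments.
Unset Strict Implicit.
Local Open Scope quotient_scope.

Lemma ker_neq0 (A B : comPzRingType) (f : {rmorphism A -> B}) :
  (forall b, exists a, f a = b) -> ~ ring_isomorphic A B ->
  exists2 a, a <> 0 & f a = 0.
Proof.
move=> /choice[g fg] niso; apply: contrapT => ker0; apply: niso; exists f.
exists g => // a; apply/subr0_eq; apply: contrapT => n0; apply: ker0.
by exists (g (f a) - a) => //; rewrite rmorphB /= fg subrr.
Qed.

Lemma germ_surj (X : topRingedSpace) (x : X) (a : stalk x) :
  exists (U : opens X) (Ux : U x) (s : sect U), a = germ Ux s.
Proof. by elim/rs_quotW: a => -[U Ux s]; exists U, Ux, s. Qed.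

Lemma germ_eq0 (X : topRingedSpace) (x : X) (U : opens X) (Ux : U x) (s : sect U) :
  germ Ux s = 0 <-> exists (W : opens X) (WU : W `<=` U), W x /\ res WU s = 0.
Proof.
rewrite /germ -rs_pi0; split=> [/rs_piP[W [WU [WT [Wx]]]]|[W [WU [Wx E]]]].
  by rewrite /= rmorph0; exists W, WU.
by apply/rs_piP; exists W, WU, (fun _ _ => Logic.I); rewrite /= rmorph0.
Qed.

(** [U] is the complement of the image of the complement of [V]; injectivity ensures that no point
    of [V] is lost. *)
Lemma closed_injective_preimage (Z X : topologicalType) (f : Z -> X) (V : opens Z) :
  injective f -> (forall C : set Z, closed C -> closed (f @` C)) ->
  exists U : opens X, forall z, U (f z) <-> V z.
Proof.
move=> finj fcl.
have oU : open (~` (f @` ~` V)).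
  by rewrite openC; apply: fcl; rewrite closedC; exact: opens_open.
exists (Opens oU) => z; split=> [/= h|Vz [z' nV /finj zz']].
  by apply: contrapT => nV; apply: h; exists z.
by apply: nV; rewrite zz'.
Qed.

(** A representative of a kernel element pulls back to zero only near [z]. Intersecting its domain
    with an open set whose trace on [Z] is that neighbourhood makes the pullback zero outright. *)
Lemma stalk_ker_section (Z X : topRingedSpace) (f : tr_morphism Z X) (z : Z) :
  closed_immersion f -> ~ ring_isomorphic (stalk (f z)) (stalk z) ->
  exists (U : opens X) (Uz : U (f z)) (s : sect U),
    germ Uz s <> 0 /\ sharp f U s = 0.
Proof.
move=> [[finj fcl] fsurj _ _] niso.
have [a] := ker_neq0 (fsurj z) niso.
have [U [Uz [s ->]]] := germ_surj a.
rewrite stalk_map_germ => s0 /germ_eq0[V [VU [Vz sV]]].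
have [U' U'V] := closed_injective_preimage V finj fcl.
have IU := @opensIl _ U U'.
exists (opensI U U'), (conj Uz ((U'V z).2 Vz)), (res IU s); split.
  move=> /germ_eq0[W [WI [Wz sW]]]; apply: s0; apply/germ_eq0.
  by exists W, (subset_trans WI IU); rewrite -sW (res_comp _ _ (subset_trans WI IU)).
rewrite sharp_res.
have IV : preopen (@tr_continuous _ _ f) (opensI U U') `<=` V.
  by move=> x [_ /U'V].
by rewrite -(res_comp VU IV) sV rmorph0.
Qed.

(** * Neighbourhoods and zero divisors in the pushout *)

Section Pushout.
Variables (X Y Z : topRingedSpace) (alpha : tr_morphism Z X) (beta : tr_morphism Z Y).

(** The hypothesis is compatibility on the generating pairs; it propagates to the whole equivalence
    relation, so membership descends to the quotient. *)
Lemma pushout_open (U : opens X) (V : opens Y) :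
  (forall z, U (alpha z) <-> V (beta z)) ->
  exists W : opens (pushout_space alpha beta),
    (forall x, W (pushl alpha beta x) <-> U x) /\
    (forall y, W (pushr alpha beta y) <-> V y).
Proof.
move=> UV.
pose P (u : X + Y) : Prop := match u with inl x => U x | inr y => V y end.
have PE u v : glue_rel alpha beta u v -> (P u <-> P v).
  elim=> [_ _ [z [-> ->]]|//|u' v' _ h|u' v' w _ h _ h']; first exact: UV.
    by rewrite h.
  by rewrite h.
pose W : set (pushout_space alpha beta) := [set w | P (repr w)].
have WE u : W (\pi_{eq_quot (glue_equiv alpha beta)} u) <-> P u.
  by apply: PE; move/eqmodP/asboolP: (reprK (\pi_{eq_quot (glue_equiv alpha beta)} u)).
have oW : open W.
  split.
    rewrite (_ : _ @^-1` _ = U); first exact: opens_open.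
    by apply/seteqP; split=> x; [exact: (WE (inl x)).1|exact: (WE (inl x)).2].
  rewrite (_ : _ @^-1` _ = V); first exact: opens_open.
  by apply/seteqP; split=> x; [exact: (WE (inr x)).1|exact: (WE (inr x)).2].
by exists (Opens oW); split=> u; exact: WE.
Qed.

Hypothesis (alpha_closed : closed_immersion alpha).
Hypothesis (beta_closed : closed_immersion beta).

(** [V] is chosen in [Y] with the same trace on [Z] as [U]. A section over [U] can then be
    restricted to the part of [W] in [X] and paired with zero on [Y]. *)
Lemma pushout_nbhsl (U : opens X) z : U (alpha z) ->
  exists W : opens (pushout_space alpha beta), W (pushz alpha beta z) /\
    preopen (@pushl_continuous _ _ _ alpha beta) W `<=` U.
Proof.
move=> Uz; have [[binj bcl] _ _ _] := beta_closed.
have [V VU] := closed_injective_preimage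
  (preopen (@tr_continuous _ _ alpha) U) binj bcl.
have [|W [Wl _]] := @pushout_open U V; first by move=> t; rewrite VU.
by exists W; split=> [|x]; [apply/Wl|move/Wl].
Qed.

Lemma pushout_nbhsr (V : opens Y) z : V (beta z) ->
  exists W : opens (pushout_space alpha beta), W (pushz alpha beta z) /\
    preopen (@pushr_continuous _ _ _ alpha beta) W `<=` V.
Proof.
move=> Vz; have [[ainj acl] _ _ _] := alpha_closed.
have [U UV] := closed_injective_preimage
  (preopen (@tr_continuous _ _ beta) V) ainj acl.
have [|W [Wl Wr]] := @pushout_open U V; first by move=> t; rewrite UV.
by exists W; split=> [|y]; [apply/Wl/UV|move/Wr].
Qed.

Lemma pushout_stalk_zero_divisors z :
  ~ ring_isomorphic (stalk (alpha z)) (stalk z) ->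
  ~ ring_isomorphic (stalk (beta z)) (stalk z) ->
  exists a b : @stalk (pushout alpha beta) (pushz alpha beta z),
    [/\ a <> 0, b <> 0 & a * b = 0].
Proof.
move=> /(stalk_ker_section alpha_closed)[U [Uz [s [s0 sa]]]].
move=> /(stalk_ker_section beta_closed)[V [Vz [t [t0 tb]]]].
have [W [Wz WU]] := pushout_nbhsl Uz.
have [W' [W'z W'V]] := pushout_nbhsr Vz.
(* Both components pull back to zero on [Z], since [sharp alpha] kills [s]. *)
have cs : (res WU s, 0) \in @push_compat _ _ _ alpha beta W.
  by rewrite unfold_in; apply/asboolP; rewrite /= sharp_res sa !rmorph0.
have ct : (0, res W'V t) \in @push_compat _ _ _ alpha beta W'.
  by rewrite unfold_in; apply/asboolP; rewrite /= sharp_res tb !rmorph0.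
exists (@germ (pushout alpha beta) _ W Wz (PushSect cs)).
exists (@germ (pushout alpha beta) _ W' W'z (PushSect ct)); split.
- move=> /germ_eq0[O [OW [Oz /(congr1 (fun u => (push_val u).1)) /= sO]]].
  apply: s0; apply/germ_eq0.
  have OU := subset_trans (preopenS (@pushl_continuous _ _ _ alpha beta) OW) WU.
  by exists (preopen (@pushl_continuous _ _ _ alpha beta) O), OU; split=> //;
    rewrite -sO (res_comp _ _ OU).
- move=> /germ_eq0[O [OW [Oz /(congr1 (fun u => (push_val u).2)) /= tO]]].
  apply: t0; apply/germ_eq0.
  have OV := subset_trans (preopenS (@pushr_continuous _ _ _ alpha beta) OW) W'V.
  exists (preopen (@pushr_continuous _ _ _ alpha beta) O), OV; split.
    (* The base point is defined through [alpha z], whereas the germ of [t] is taken at [beta z]. *)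
    by rewrite /= -push_glue.
  by rewrite -tO (res_comp _ _ OV).
- rewrite /germ -rs_piM -rs_pi0; apply/rs_piP.
  exists (opensI W W'), (@subset_refl _ _), (fun _ _ => Logic.I); split=> //.
  rewrite res_id rmorph0.
  by apply: push_sectP; rewrite /= rmorph0 ?mulr0 ?mul0r.
Qed.

End Pushout.
End Gluing.

Theorem theorem5p5 (X Y Z : topRingedSpace)
  (hX : locally_noetherian_formal_scheme X)
  (hY : locally_noetherian_formal_scheme Y)
  (hZ : locally_noetherian_formal_scheme Z)
  (Z_neq0 : [set: Z] !=set0)
  (alpha : tr_morphism Z X) (beta : tr_morphism Z Y)
  (alpha_local : local_on_stalks alpha) (beta_local : local_on_stalks beta)
  (alpha_closed : closed_immersion alpha) (beta_closed : closed_immersion beta)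
  (alpha_not_iso : forall z : Z, ~ ring_isomorphic (stalk (alpha z)) (stalk z))
  (beta_not_iso : forall z : Z, ~ ring_isomorphic (stalk (beta z)) (stalk z)) :
  exists w : pushout alpha beta, singular_at w.
Proof.
have [z _] := Z_neq0; exists (pushz alpha beta z) => /regular_local_ring_prime0.
have [a [b [a0 b0 ab]]] := pushout_stalk_zero_divisors alpha_closed beta_closed
  (alpha_not_iso z) (beta_not_iso z).
by case=> _ _ /(_ _ _ ab) [/a0|/b0].
Qed.
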